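(* Let $\Bbbk$ be an algebraically closed field of characteristic $p>0$, let $n$ be a positive integer, and let $K=\Bbbk[C_p^n]^*$ be the dual of the group algebra of $C_p^n$. For any finite-dimensional commutative $K$-module algebra $A$ over $\Bbbk$, the second Sweedler cohomology group $H^2_{sw}(K,A)$ is trivial.
   Context: $C_p$ is the cyclic group of order $p$ and $C_p^n$ the direct product of $n$ copies. Sweedler cohomology: let $K$ be a cocommutative Hopf algebra and $A$ a commutative (left) $K$-module algebra. For $n\ge 0$ let $\mathrm{Reg}^n(K,A)$ be the abelian group (under convolution $*$) of convolution-invertible linear maps $K^{\otimes n}\to A$. For $f\in \mathrm{Reg}^n(K,A)$ define $d^i(f)\in \mathrm{Reg}^{n+1}(K,A)$ by $d^0(f)(h_0\otimes\cdots\otimes h_n)=h_0\cdot f(h_1\otimes\cdots\otimes h_n)$, $d^i(f)(h_0\otimes\cdots\otimes h_n)=f(h_0\otimes\cdots\otimes h_{i-1}h_i\otimes\cdots\otimes h_n)$ for $1\le i\le n$, and $d^{n+1}(f)(h_0\otimes\cdots\otimes h_n)=f(h_0\otimes\cdots\otimes h_{n-1})\epsilon(h_n)$. The differential is $\partial^n(f)=d^0(f)*d^1(f^{-1})*d^2(f)*\cdots*d^{n+1}(f^{\pm1})$, where $f^{-1}$ is the convolution inverse. Then $H^n_{sw}(K,A)=\ker\partial^n/\mathrm{Im}\,\partial^{n-1}$ (with $\partial^{-1}$ trivial). *)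

(* Defs.v *)
From HB Require Import structures.
From mathcomp Require Import all_boot all_order all_algebra all_fingroup.
From mathcomp Require Import falgebra.

Set Implicit Arguments.
Unset Strict Implicit.
Unset Printing Implicit Defensive.

Import GRing.Theory.
Local Open Scope ring_scope.

(* An element of U (x) V is written as a finite sum of pure tensors, i.e. as a
   list of pairs; two lists denote the same tensor iff every bilinear map out
   of U * V takes the same total value on them (universal property). *)
Definition teq (k : fieldType) (U V : lmodType k) (s t : seq (U * V)) : Prop :=
  forall (W : lmodType k) (b : U -> V -> W), bilinear_for *:%R *:%R b ->
    \sum_(c <- s) b c.1 c.2 = \sum_(c <- t) b c.1 c.2.

Definition trilinear (k : fieldType) (U V X W : lmodType k)
    (b : U -> V -> X -> W) : Prop :=
  [/\ forall v x, linear (fun u => b u v x),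
      forall u x, linear (fun v => b u v x)
    & forall u v, linear (fun x => b u v x)].

Definition teq3 (k : fieldType) (U V X : lmodType k)
    (s t : seq (U * V * X)) : Prop :=
  forall (W : lmodType k) (b : U -> V -> X -> W), trilinear b ->
    \sum_(c <- s) b c.1.1 c.1.2 c.2 = \sum_(c <- t) b c.1.1 c.1.2 c.2.

(* [comul h] lists the Sweedler components (h_(1), h_(2)) of h. *)
HB.mixin Record Algebra_isHopf (k : fieldType) H of GRing.Algebra k H := {
  comul : H -> seq (H * H);
  counit : H -> k;
  antipode : H -> H;
  comul_linear : forall (a : k) (x y : H),
    teq (comul (a *: x + y)) ([seq (a *: c.1, c.2) | c <- comul x] ++ comul y);
  comulA : forall x : H,
    teq3 [seq (d.1, d.2, c.2) | c <- comul x, d <- comul c.1]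
         [seq (c.1, d.1, d.2) | c <- comul x, d <- comul c.2];
  counit_linear : linear (counit : H -> k^o);
  counitl : forall x : H, \sum_(c <- comul x) counit c.1 *: c.2 = x;
  counitr : forall x : H, \sum_(c <- comul x) counit c.2 *: c.1 = x;
  comul1 : teq (comul 1) [:: (1, 1)];
  comulM : forall x y : H,
    teq (comul (x * y))
        [seq (c.1 * d.1, c.2 * d.2) | c <- comul x, d <- comul y];
  counit1 : counit 1 = 1;
  counitM : forall x y : H, counit (x * y) = counit x * counit y;
  antipode_linear : linear antipode;
  antipodel : forall x : H, \sum_(c <- comul x) antipode c.1 * c.2 = (counit x)%:A;
  antipoder : forall x : H, \sum_(c <- comul x) c.1 * antipode c.2 = (counit x)%:A
}.

#[short(type="hopfAlgType")]
HB.structure Definition HopfAlgebra (k : fieldType) :=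
  {H of GRing.Algebra k H & Algebra_isHopf k H}.

#[short(type="finHopfAlgType")]
HB.structure Definition FinHopfAlgebra (k : fieldType) :=
  {H of HopfAlgebra k H & Falgebra k H}.

#[short(type="comFalgType")]
HB.structure Definition ComFalgebra (k : fieldType) :=
  {A of Falgebra k A & GRing.ComNzRing A}.

Definition cocommutative (k : fieldType) (H : hopfAlgType k) : Prop :=
  forall x : H, teq (comul x) [seq (c.2, c.1) | c <- comul x].

Section BilinearFacts.
Variables (k : fieldType) (U V W : lmodType k) (b : U -> V -> W).
Hypothesis bb : bilinear_for *:%R *:%R b.

Lemma bilZl a u v : b (a *: u) v = a *: b u v.
Proof. exact: (scalable_linear (bb.1 v)). Qed.

Lemma bilZr a u v : b u (a *: v) = a *: b u v.
Proof. exact: (scalable_linear (bb.2 u)). Qed.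

Lemma bilDl u u' v : b (u + u') v = b u v + b u' v.
Proof. by have := bb.1 v 1 u u'; rewrite /= !scale1r. Qed.

Lemma bilDr u v v' : b u (v + v') = b u v + b u v'.
Proof. by have := bb.2 u 1 v v'; rewrite /= !scale1r. Qed.

Lemma bil_suml (I : Type) (r : seq I) (P : pred I) (F : I -> U) v :
  b (\sum_(i <- r | P i) F i) v = \sum_(i <- r | P i) b (F i) v.
Proof.
have b0 : b 0 v = 0 by rewrite -(scale0r 0) bilZl scale0r.
by apply: (big_morph (b^~ v)) => // x y; rewrite bilDl.
Qed.

Lemma bil_sumr (I : Type) (r : seq I) (P : pred I) (F : I -> V) u :
  b u (\sum_(i <- r | P i) F i) = \sum_(i <- r | P i) b u (F i).
Proof.
have b0 : b u 0 = 0 by rewrite -(scale0r 0) bilZr scale0r.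
by apply: (big_morph (b u)) => // x y; rewrite bilDr.
Qed.

End BilinearFacts.

Definition group_algebra (k : fieldType) (G : finGroupType) : Type :=
  {ffun G -> k^o}.

Section GroupAlgebra.
Variables (k : fieldType) (G : finGroupType).

HB.instance Definition _ := Vector.on (group_algebra k G).

Local Notation kG := (group_algebra k G).
Implicit Types (x y z : kG) (g h : G).

Definition gdelta g : kG := [ffun h => (h == g)%:R].

Definition galg_mul x y : kG :=
  [ffun g => \sum_(a : G) \sum_(b : G | (a * b)%g == g) x a * y b].

Lemma galg_sumE (I : Type) (r : seq I) (P : pred I) (F : I -> kG) g :
  (\sum_(i <- r | P i) F i) g = \sum_(i <- r | P i) F i g.
Proof.
elim/big_rec2: _ => [|i v x _ <-]; first by rewrite ffunE.
by rewrite ffunE.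
Qed.

Lemma galg_basis x : x = \sum_g x g *: gdelta g.
Proof.
apply/ffunP=> h; rewrite galg_sumE (bigD1 h) //= !ffunE eqxx.
rewrite /GRing.scale /= mulr1 big1 ?addr0 // => g neq_gh.
by rewrite !ffunE eq_sym (negPf neq_gh) /GRing.scale /= mulr0.
Qed.

Lemma galg_mul_bilinear : bilinear_for *:%R *:%R galg_mul.
Proof.
split=> [y|x] a u v; apply/ffunP=> g; rewrite !ffunE scaler_sumr -big_split /=.
  apply: eq_bigr => i _; rewrite scaler_sumr -big_split; apply: eq_bigr => j _.
  by rewrite !ffunE /GRing.scale /= mulrDl mulrA.
apply: eq_bigr => i _; rewrite scaler_sumr -big_split; apply: eq_bigr => j _.
by rewrite !ffunE /GRing.scale /= mulrDr mulrCA.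
Qed.

Lemma galg_mul_delta g h : galg_mul (gdelta g) (gdelta h) = gdelta (g * h)%g.
Proof.
apply/ffunP=> c; rewrite !ffunE (bigD1 g) //= [X in _ + X]big1 ?addr0; last first.
  by move=> a nag; rewrite big1 // => b _; rewrite !ffunE (negPf nag) mul0r.
rewrite big_mkcond (bigD1 h) //= !ffunE !eqxx mulr1 big1 ?addr0.
  by rewrite eq_sym; case: ifP.
by move=> b nbh; rewrite !ffunE (negPf nbh) mulr0; case: ifP.
Qed.

Lemma galg_bilE (W : lmodType k) (b : kG -> kG -> W) x y :
    bilinear_for *:%R *:%R b ->
  b x y = \sum_g \sum_h (x g * y h) *: b (gdelta g) (gdelta h).
Proof.
move=> bb; rewrite {1}(galg_basis x) {1}(galg_basis y) (bil_suml bb).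
apply: eq_bigr => g _; rewrite (bil_sumr bb).
by apply: eq_bigr => h _; rewrite (bilZl bb) (bilZr bb) scalerA.
Qed.

Lemma galg_mulE x y :
  galg_mul x y = \sum_g \sum_h (x g * y h) *: gdelta (g * h)%g.
Proof.
rewrite (galg_bilE x y galg_mul_bilinear).
by apply: eq_bigr => g _; apply: eq_bigr => h _; rewrite galg_mul_delta.
Qed.

Lemma galg_mulZl a x y : galg_mul (a *: x) y = a *: galg_mul x y.
Proof. exact: bilZl galg_mul_bilinear _ _ _. Qed.

Lemma galg_mulZr a x y : galg_mul x (a *: y) = a *: galg_mul x y.
Proof. exact: bilZr galg_mul_bilinear _ _ _. Qed.

Lemma galg_mulDl : left_distributive galg_mul +%R.
Proof. by move=> x y z; rewrite (bilDl galg_mul_bilinear). Qed.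

Lemma galg_mulDr : right_distributive galg_mul +%R.
Proof. by move=> x y z; rewrite (bilDr galg_mul_bilinear). Qed.

Lemma galg_mul1 : left_id (gdelta 1%g) galg_mul.
Proof.
move=> x; rewrite {1}(galg_basis x) (bil_sumr galg_mul_bilinear).
rewrite [RHS]galg_basis; apply: eq_bigr => g _.
by rewrite galg_mulZr galg_mul_delta mul1g.
Qed.

Lemma galg_1mul : right_id (gdelta 1%g) galg_mul.
Proof.
move=> x; rewrite {1}(galg_basis x) (bil_suml galg_mul_bilinear).
rewrite [RHS]galg_basis; apply: eq_bigr => g _.
by rewrite galg_mulZl galg_mul_delta mulg1.
Qed.

Lemma galg_mulA : associative galg_mul.
Proof.
have bb := galg_mul_bilinear.
move=> x y z; rewrite (galg_basis x) !(bil_suml bb); apply: eq_bigr => g _.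
rewrite !galg_mulZl; congr (_ *: _).
rewrite (galg_basis y) (bil_suml bb) !(bil_sumr bb) (bil_suml bb).
apply: eq_bigr => h _; rewrite !(galg_mulZl, galg_mulZr); congr (_ *: _).
rewrite (galg_basis z) !(bil_sumr bb).
apply: eq_bigr => j _; rewrite !(galg_mulZl, galg_mulZr); congr (_ *: _).
by rewrite !galg_mul_delta mulgA.
Qed.

Lemma galg_1neq0 : gdelta 1%g != 0.
Proof.
by apply/eqP => /ffunP/(_ 1%g); rewrite !ffunE eqxx => /eqP; rewrite oner_eq0.
Qed.

HB.instance Definition _ := GRing.Zmodule_isNzRing.Build kG
  galg_mulA galg_mul1 galg_1mul galg_mulDl galg_mulDr galg_1neq0.

HB.instance Definition _ := GRing.Lmodule_isLalgebra.Build k kG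
  (fun a u v => esym (galg_mulZl a u v)).

HB.instance Definition _ := GRing.Lalgebra_isAlgebra.Build k kG
  (fun a u v => esym (galg_mulZr a u v)).

Definition galg_comul x : seq (kG * kG) :=
  [seq (x g *: gdelta g, gdelta g) | g <- enum G].
Definition galg_counit x : k := \sum_(g : G) x g.
Definition galg_antipode x : kG := [ffun g => x g^-1%g].

Lemma gdeltaM g h : gdelta g * gdelta h = gdelta (g * h)%g.
Proof. exact: galg_mul_delta. Qed.

Lemma gdelta1 : gdelta 1%g = 1. Proof. by []. Qed.

Lemma galg_comulE (W : nmodType) (b : kG -> kG -> W) x :
  \sum_(c <- galg_comul x) b c.1 c.2 = \sum_g b (x g *: gdelta g) (gdelta g).
Proof. by rewrite big_map /= big_enum. Qed.

Lemma galg_comul_bilE (W : lmodType k) (b : kG -> kG -> W) x :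
    bilinear_for *:%R *:%R b ->
  \sum_(c <- galg_comul x) b c.1 c.2 = \sum_g x g *: b (gdelta g) (gdelta g).
Proof.
by move=> bb; rewrite galg_comulE; apply: eq_bigr => g _; rewrite (bilZl bb).
Qed.

Lemma sum_gdelta (W : lmodType k) (F : G -> W) h :
  \sum_g gdelta h g *: F g = F h.
Proof.
rewrite (bigD1 h) //= ffunE eqxx scale1r big1 ?addr0 // => g ngh.
by rewrite ffunE (negPf ngh) scale0r.
Qed.

Lemma galg_linE (W : lmodType k) (F : G -> W) :
  linear (fun x : kG => \sum_g x g *: F g).
Proof.
move=> a x y; rewrite scaler_sumr -big_split; apply: eq_bigr => g _.
by rewrite !ffunE scalerDl scalerA.
Qed.

Lemma galg_lin_sum (W : lmodType k) (L : kG -> W) x :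
  linear L -> L x = \sum_g x g *: L (gdelta g).
Proof.
move=> linL; pose lL := GRing.isLinear.Build k kG W *:%R L linL.
pose L' : {linear kG -> W} := HB.pack L lL.
rewrite {1}(galg_basis x) -[L]/(L' : _ -> _) linear_sum.
by apply: eq_bigr => g _; rewrite linearZ.
Qed.

Lemma galg_comul_linear (a : k) x y :
  teq (galg_comul (a *: x + y))
      ([seq (a *: c.1, c.2) | c <- galg_comul x] ++ galg_comul y).
Proof.
move=> W b bb; rewrite big_cat /= !(galg_comul_bilE _ bb) big_map /=.
rewrite (galg_comulE (fun u v => b (a *: u) v)) galg_linE scaler_sumr.
by congr (_ + _); apply: eq_bigr => g _; rewrite !(bilZl bb).
Qed.

Lemma galg_comulA x :
  teq3 [seq (d.1, d.2, c.2) | c <- galg_comul x, d <- galg_comul c.1]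
       [seq (c.1, d.1, d.2) | c <- galg_comul x, d <- galg_comul c.2].
Proof.
move=> W b [b1 b2 b3]; rewrite !big_allpairs_dep /=.
rewrite (galg_comulE (fun u v => \sum_(d <- galg_comul u) b d.1 d.2 v)).
rewrite (galg_comulE (fun u v => \sum_(d <- galg_comul v) b u d.1 d.2)).
apply: eq_bigr => g _.
rewrite (galg_comul_bilE (b := fun u v => b u v (gdelta g))); last first.
  by split=> [v | u]; [apply: b1 | apply: b2].
rewrite (galg_comul_bilE (b := fun u v => b (x g *: gdelta g) u v)); last first.
  by split=> [v | u]; [apply: b2 | apply: b3].
rewrite sum_gdelta (scalable_linear (b1 _ _)) /=.
under eq_bigr => h _ do rewrite ffunE -scalerA.
by rewrite -scaler_sumr sum_gdelta.
Qed.

Lemma galg_counit_linear : linear (galg_counit : kG -> k^o).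
Proof.
move=> a x y; rewrite /galg_counit scaler_sumr -big_split /=.
by apply: eq_bigr => g _; rewrite !ffunE.
Qed.

Lemma galg_counit_delta g : galg_counit (gdelta g) = 1.
Proof.
rewrite /galg_counit (bigD1 g) //= ffunE eqxx big1 ?addr0 // => h nhg.
by rewrite ffunE (negPf nhg).
Qed.

Lemma galg_counitZ a x : galg_counit (a *: x) = a * galg_counit x.
Proof. exact: (scalable_linear galg_counit_linear). Qed.

Lemma galg_counitl x : \sum_(c <- galg_comul x) galg_counit c.1 *: c.2 = x.
Proof.
rewrite (galg_comulE (fun u v => galg_counit u *: v)) [RHS]galg_basis.
by apply: eq_bigr => g _; rewrite galg_counitZ galg_counit_delta mulr1.
Qed.

Lemma galg_counitr x : \sum_(c <- galg_comul x) galg_counit c.2 *: c.1 = x.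
Proof.
rewrite (galg_comulE (fun u v => galg_counit v *: u)) [RHS]galg_basis.
by apply: eq_bigr => g _; rewrite galg_counit_delta scale1r.
Qed.

Lemma galg_comul1 : teq (galg_comul 1) [:: (1, 1)].
Proof. by move=> W b bb; rewrite big_seq1 (galg_comul_bilE _ bb) sum_gdelta. Qed.

Lemma galg_comulM x y :
  teq (galg_comul (x * y))
      [seq (c.1 * d.1, c.2 * d.2) | c <- galg_comul x, d <- galg_comul y].
Proof.
move=> W b bb; rewrite big_allpairs_dep /= (galg_comul_bilE _ bb).
rewrite (galg_comulE
  (fun u v => \sum_(d <- galg_comul y) b (u * d.1) (v * d.2))).
under [RHS]eq_bigr => g _.
  rewrite (galg_comulE (fun u v => b (x g *: gdelta g * u) (gdelta g * v))).
  over.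
pose L (z : kG) := \sum_g z g *: b (gdelta g) (gdelta g).
have bL : bilinear_for *:%R *:%R (fun u v : kG => L (u * v)).
  split=> [v | u] a w z; rewrite /L /=.
    by rewrite mulrDl -scalerAl galg_linE.
  by rewrite mulrDr -scalerAr galg_linE.
rewrite -/(L (x * y)) (galg_bilE x y bL).
apply: eq_bigr => g _; apply: eq_bigr => h _.
by rewrite -scalerAl -scalerAr !(bilZl bb) scalerA !gdeltaM /L sum_gdelta.
Qed.

Lemma galg_counit1 : galg_counit 1 = 1.
Proof. exact: galg_counit_delta. Qed.

Lemma galg_counitM x y : galg_counit (x * y) = galg_counit x * galg_counit y.
Proof.
pose L (z : kG) : k^o := galg_counit z.
have bL : bilinear_for *:%R *:%R (fun u v : kG => L (u * v)).
  split=> [v | u] a w z; rewrite /L /=.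
    by rewrite mulrDl -scalerAl galg_counit_linear.
  by rewrite mulrDr -scalerAr galg_counit_linear.
rewrite -/(L (x * y)) (galg_bilE x y bL) /galg_counit mulr_suml.
apply: eq_bigr => g _; rewrite mulr_sumr; apply: eq_bigr => h _.
by rewrite /L gdeltaM galg_counit_delta /GRing.scale /= mulr1.
Qed.

Lemma galg_antipode_linear : linear galg_antipode.
Proof. by move=> a x y; apply/ffunP=> g; rewrite !ffunE. Qed.

Lemma galg_antipode_delta g : galg_antipode (gdelta g) = gdelta g^-1%g.
Proof.
by apply/ffunP=> h; rewrite !ffunE -(inj_eq invg_inj) invgK.
Qed.

Lemma galg_antipodel x :
  \sum_(c <- galg_comul x) galg_antipode c.1 * c.2 = (galg_counit x)%:A.
Proof.
rewrite (galg_comulE (fun u v => galg_antipode u * v)) scaler_suml.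
apply: eq_bigr => g _; rewrite (scalable_linear galg_antipode_linear) /=.
by rewrite galg_antipode_delta -scalerAl gdeltaM mulVg.
Qed.

Lemma galg_antipoder x :
  \sum_(c <- galg_comul x) c.1 * galg_antipode c.2 = (galg_counit x)%:A.
Proof.
rewrite (galg_comulE (fun u v => u * galg_antipode v)) scaler_suml.
apply: eq_bigr => g _.
by rewrite galg_antipode_delta -scalerAl gdeltaM mulgV.
Qed.

HB.instance Definition _ := Algebra_isFalgebra.Build k kG.

HB.instance Definition _ := Algebra_isHopf.Build k kG
  galg_comul_linear galg_comulA galg_counit_linear galg_counitl galg_counitr
  galg_comul1 galg_comulM galg_counit1 galg_counitM
  galg_antipode_linear galg_antipodel galg_antipoder.

End GroupAlgebra.

Definition dual (k : fieldType) (H : finHopfAlgType k) : Type := 'Hom(H, k^o).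

Section Dual.
Variables (k : fieldType) (H : finHopfAlgType k).

HB.instance Definition _ := Vector.on (dual H).

Local Notation D := (dual H).
Implicit Types (f g : D) (x y : H).

Definition dapp f x : k := (f : 'Hom(H, k^o)) x.

Lemma dapp_linear f : linear (dapp f : H -> k^o).
Proof. by move=> a x y; rewrite /dapp linearP. Qed.

Lemma dapp_linearl x : linear (fun f => dapp f x : k^o).
Proof. by move=> a f g; rewrite /dapp add_lfunE scale_lfunE. Qed.

Lemma dualP f g : (forall x, dapp f x = dapp g x) -> f = g.
Proof. by move=> fg; apply/lfunP. Qed.

Lemma dappD f g x : dapp (f + g) x = dapp f x + dapp g x.
Proof. by rewrite /dapp add_lfunE. Qed.

Lemma dappZ a f x : dapp (a *: f) x = a * dapp f x.
Proof. by rewrite /dapp scale_lfunE. Qed.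

Lemma dapp_sum (I : Type) (r : seq I) (P : pred I) (F : I -> D) x :
  dapp (\sum_(i <- r | P i) F i) x = \sum_(i <- r | P i) dapp (F i) x.
Proof. by rewrite /dapp sum_lfunE. Qed.

Lemma dapp_bil f g :
  bilinear_for *:%R *:%R (fun x y => dapp f x * dapp g y : k^o).
Proof.
split=> [y | x] a u v /=; rewrite dapp_linear /GRing.scale /=.
  by rewrite mulrDl mulrA.
by rewrite mulrDr mulrCA.
Qed.

Definition mkdual (L : H -> k) : D := linfun (L : H -> k^o).

Lemma mkdualE (L : H -> k) x : linear (L : H -> k^o) -> dapp (mkdual L) x = L x.
Proof.
move=> linL; pose lL := GRing.isLinear.Build k H k^o *:%R L linL.
pose L' : {linear H -> k^o} := HB.pack (L : H -> k^o) lL.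
by rewrite /dapp /mkdual -[L]/(L' : _ -> _) lfunE.
Qed.

Definition dual_mul f g : D :=
  mkdual (fun x => \sum_(c <- comul x) dapp f c.1 * dapp g c.2).

Lemma comul_sum_linear (W : lmodType k) (b : H -> H -> W) :
  bilinear_for *:%R *:%R b ->
  linear (fun x => \sum_(c <- comul x) b c.1 c.2).
Proof.
move=> bb a x y /=; rewrite (comul_linear a x y _ _ bb) big_cat big_map /=.
by rewrite scaler_sumr; congr (_ + _); apply: eq_bigr => c _; rewrite (bilZl bb).
Qed.

Lemma dual_mulE f g x :
  dapp (dual_mul f g) x = \sum_(c <- comul x) dapp f c.1 * dapp g c.2.
Proof. by rewrite mkdualE //; apply: (comul_sum_linear (dapp_bil f g)). Qed.

Definition dual_one : D := mkdual counit.

Lemma dual_oneE x : dapp dual_one x = counit x.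
Proof. by rewrite mkdualE //; apply: counit_linear. Qed.

Lemma dual_mulA : associative dual_mul.
Proof.
move=> f g h; apply: dualP => x; rewrite !dual_mulE.
pose b (u v w : H) : k^o := dapp f u * dapp g v * dapp h w.
have tb : trilinear b.
  split=> [v w | u w | u v] a y z; rewrite /b dapp_linear /GRing.scale /=.
  - by rewrite !mulrDl !mulrA.
  - by rewrite mulrDr mulrDl mulrCA !mulrA.
  - by rewrite mulrDr mulrCA.
have := comulA x _ _ tb; rewrite !big_allpairs_dep /= => e.
transitivity (\sum_(c <- comul x) \sum_(d <- comul c.2) b c.1 d.1 d.2).
  apply: eq_bigr => c _; rewrite dual_mulE mulr_sumr.
  by apply: eq_bigr => d _; rewrite mulrA.
by rewrite -e; apply: eq_bigr => c _; rewrite dual_mulE mulr_suml.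
Qed.

Lemma dapp_comb (I : Type) (r : seq I) (F : I -> k) (G : I -> H) f :
  dapp f (\sum_(i <- r) F i *: G i) = \sum_(i <- r) F i * dapp f (G i).
Proof.
by rewrite /dapp linear_sum; apply: eq_bigr => i _; rewrite linearZ.
Qed.

Lemma dual_mul1 : left_id dual_one dual_mul.
Proof.
move=> f; apply: dualP => x; rewrite dual_mulE.
under eq_bigr => c _ do rewrite dual_oneE.
by rewrite -dapp_comb counitl.
Qed.

Lemma dual_1mul : right_id dual_one dual_mul.
Proof.
move=> f; apply: dualP => x; rewrite dual_mulE.
under eq_bigr => c _ do rewrite dual_oneE mulrC.
by rewrite -dapp_comb counitr.
Qed.

Lemma dual_mulDl : left_distributive dual_mul +%R.
Proof.
move=> f g h; apply: dualP => x; rewrite dappD !dual_mulE -big_split.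
by apply: eq_bigr => c _; rewrite dappD mulrDl.
Qed.

Lemma dual_mulDr : right_distributive dual_mul +%R.
Proof.
move=> f g h; apply: dualP => x; rewrite dappD !dual_mulE -big_split.
by apply: eq_bigr => c _; rewrite dappD mulrDr.
Qed.

Lemma dual_1neq0 : dual_one != 0.
Proof.
apply/eqP => /(congr1 (fun f => dapp f 1)).
rewrite dual_oneE counit1 /dapp zero_lfunE => /eqP; exact/negP/oner_neq0.
Qed.

HB.instance Definition _ := GRing.Zmodule_isNzRing.Build D
  dual_mulA dual_mul1 dual_1mul dual_mulDl dual_mulDr dual_1neq0.

Lemma dual_scalerAl (a : k) f g : a *: (f * g) = (a *: f) * g.
Proof.
apply: dualP => x; rewrite dappZ !dual_mulE mulr_sumr.
by apply: eq_bigr => c _; rewrite dappZ mulrA.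
Qed.

HB.instance Definition _ := GRing.Lmodule_isLalgebra.Build k D dual_scalerAl.

Lemma dual_scalerAr (a : k) f g : a *: (f * g) = f * (a *: g).
Proof.
apply: dualP => x; rewrite dappZ !dual_mulE mulr_sumr.
by apply: eq_bigr => c _; rewrite dappZ mulrCA.
Qed.

HB.instance Definition _ := GRing.Lalgebra_isAlgebra.Build k D dual_scalerAr.

HB.instance Definition _ := Algebra_isFalgebra.Build k D.

Lemma dappM f g x : dapp (f * g) x = \sum_(c <- comul x) dapp f c.1 * dapp g c.2.
Proof. exact: dual_mulE. Qed.

Lemma dapp1 x : dapp 1 x = counit x.
Proof. exact: dual_oneE. Qed.

Local Notation e := (vbasis {:H}).
Local Notation N := (\dim {:H}).

Definition dcoord i : D := mkdual (coord e i).

Lemma dcoordE i x : dapp (dcoord i) x = coord e i x.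
Proof. by rewrite mkdualE // => a u v; rewrite linearP. Qed.

Lemma basis_expand x : x = \sum_(i < N) dapp (dcoord i) x *: e`_i.
Proof.
rewrite {1}(coord_vbasis (memvf x)).
by apply: eq_bigr => i _; rewrite dcoordE.
Qed.

Lemma dual_expand f : f = \sum_(i < N) dapp f e`_i *: dcoord i.
Proof.
apply: dualP => x; rewrite dapp_sum {1}(basis_expand x) dapp_comb.
by apply: eq_bigr => i _; rewrite dappZ mulrC.
Qed.

(* The transpose of the multiplication of H, under the identification of
   D (x) D with the dual of H (x) H: f |-> (x (x) y |-> f (x y)), expanded in
   the basis of D (x) D dual to a basis of H (x) H; see [dual_comul_app]. *)
Definition dual_comul f : seq (D * D) :=
  [seq (dapp f (e`_i * e`_j) *: dcoord i, dcoord j)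
     | i : 'I_N <- enum 'I_N, j : 'I_N <- enum 'I_N].
Definition dual_counit f : k := dapp f 1.
Definition dual_antipode f : D := mkdual (fun x => dapp f (antipode x)).

Lemma dual_comul_sum (W : nmodType) (b : D -> D -> W) f :
  \sum_(c <- dual_comul f) b c.1 c.2 =
  \sum_(i < N) \sum_(j < N) b (dapp f (e`_i * e`_j) *: dcoord i) (dcoord j).
Proof.
rewrite big_allpairs_dep /= big_enum; apply: eq_bigr => i _.
by rewrite big_enum.
Qed.

Lemma dapp_linM f x y :
  dapp f (x * y) =
  \sum_(i < N) \sum_(j < N) dapp (dcoord i) x * dapp (dcoord j) y * dapp f (e`_i * e`_j).
Proof.
rewrite {1}(basis_expand x) mulr_suml.
under eq_bigr => i _ do rewrite -scalerAl.
rewrite dapp_comb; apply: eq_bigr => i _.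
rewrite {1}(basis_expand y) mulr_sumr.
under eq_bigr => j _ do rewrite -scalerAr.
rewrite dapp_comb mulr_sumr; apply: eq_bigr => j _.
by rewrite mulrA.
Qed.

Lemma dual_comul_app f x y :
  \sum_(c <- dual_comul f) dapp c.1 x * dapp c.2 y = dapp f (x * y).
Proof.
rewrite (dual_comul_sum (fun u v => dapp u x * dapp v y)) dapp_linM.
apply: eq_bigr => i _; apply: eq_bigr => j _.
by rewrite dappZ -[LHS]mulrA [LHS]mulrC.
Qed.

(* Tensors over D are determined by their values on pure tensors over H. *)
Lemma teq_dual (s t : seq (D * D)) :
  (forall x y, \sum_(c <- s) dapp c.1 x * dapp c.2 y
             = \sum_(c <- t) dapp c.1 x * dapp c.2 y) -> teq s t.
Proof.
move=> st W b bb.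
have key (r : seq (D * D)) : \sum_(c <- r) b c.1 c.2 =
    \sum_(i < N) \sum_(j < N) (\sum_(c <- r) dapp c.1 e`_i * dapp c.2 e`_j)
                    *: b (dcoord i) (dcoord j).
  transitivity (\sum_(c <- r) \sum_(i < N) \sum_(j < N)
      (dapp c.1 e`_i * dapp c.2 e`_j) *: b (dcoord i) (dcoord j)).
    apply: eq_bigr => c _; rewrite {1}(dual_expand c.1) {1}(dual_expand c.2).
    rewrite (bil_suml bb); apply: eq_bigr => i _.
    rewrite (bil_sumr bb); apply: eq_bigr => j _.
    by rewrite (bilZl bb) (bilZr bb) scalerA.
  rewrite exchange_big; apply: eq_bigr => i _ /=.
  rewrite exchange_big; apply: eq_bigr => j _ /=.
  by rewrite scaler_suml.
by rewrite !key; apply: eq_bigr => i _; apply: eq_bigr => j _; rewrite st.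
Qed.

Lemma teq3_dual (s t : seq (D * D * D)) :
  (forall x y z, \sum_(c <- s) dapp c.1.1 x * dapp c.1.2 y * dapp c.2 z
               = \sum_(c <- t) dapp c.1.1 x * dapp c.1.2 y * dapp c.2 z) ->
  teq3 s t.
Proof.
move=> st W b [b1 b2 b3].
have B12 w : bilinear_for *:%R *:%R (fun u v => b u v w) by split=> ?; auto.
have B23 u : bilinear_for *:%R *:%R (fun v w => b u v w) by split=> ?; auto.
have key (r : seq (D * D * D)) : \sum_(c <- r) b c.1.1 c.1.2 c.2 =
    \sum_(i < N) \sum_(j < N) \sum_(l < N)
      (\sum_(c <- r) dapp c.1.1 e`_i * dapp c.1.2 e`_j * dapp c.2 e`_l)
        *: b (dcoord i) (dcoord j) (dcoord l).
  transitivity (\sum_(c <- r) \sum_(i < N) \sum_(j < N) \sum_(l < N)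
      (dapp c.1.1 e`_i * dapp c.1.2 e`_j * dapp c.2 e`_l)
        *: b (dcoord i) (dcoord j) (dcoord l)).
    apply: eq_bigr => -[[u v] w] _ /=.
    rewrite {1}(dual_expand u) (bil_suml (B12 w)); apply: eq_bigr => i _.
    rewrite (bilZl (B12 w)) {1}(dual_expand v) (bil_sumr (B12 w)) scaler_sumr.
    apply: eq_bigr => j _.
    rewrite (bilZr (B12 w)) {1}(dual_expand w) (bil_sumr (B23 _)) !scaler_sumr.
    by apply: eq_bigr => l _; rewrite (bilZr (B23 _)) !scalerA.
  rewrite exchange_big; apply: eq_bigr => i _ /=.
  rewrite exchange_big; apply: eq_bigr => j _ /=.
  rewrite exchange_big; apply: eq_bigr => l _ /=.
  by rewrite scaler_suml.
rewrite !key; apply: eq_bigr => i _; apply: eq_bigr => j _.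
by apply: eq_bigr => l _; rewrite st.
Qed.

Lemma dual_comul_linear (a : k) f g :
  teq (dual_comul (a *: f + g))
      ([seq (a *: c.1, c.2) | c <- dual_comul f] ++ dual_comul g).
Proof.
apply: teq_dual => x y; rewrite big_cat [in X in _ = X + _]big_map /=.
rewrite !dual_comul_app dappD dappZ; congr (_ + _).
rewrite -dual_comul_app mulr_sumr; apply: eq_bigr => c _.
by rewrite dappZ mulrA.
Qed.

Lemma dual_comulA f :
  teq3 [seq (d.1, d.2, c.2) | c <- dual_comul f, d <- dual_comul c.1]
       [seq (c.1, d.1, d.2) | c <- dual_comul f, d <- dual_comul c.2].
Proof.
apply: teq3_dual => x y z; rewrite [LHS]big_allpairs_dep [RHS]big_allpairs_dep /=.
transitivity (dapp f (x * y * z)).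
  rewrite -dual_comul_app; apply: eq_bigr => c _.
  by rewrite -mulr_suml dual_comul_app.
rewrite -mulrA -dual_comul_app; apply: eq_bigr => c _.
rewrite -dual_comul_app mulr_sumr.
by apply: eq_bigr => d _; rewrite mulrA.
Qed.

Lemma dual_counit_linear : linear (dual_counit : D -> k^o).
Proof. exact: dapp_linearl. Qed.

Lemma dual_counitl f : \sum_(c <- dual_comul f) dual_counit c.1 *: c.2 = f.
Proof.
apply: dualP => x; rewrite dapp_sum -{2}(mul1r x) -dual_comul_app.
by apply: eq_bigr => c _; rewrite dappZ.
Qed.

Lemma dual_counitr f : \sum_(c <- dual_comul f) dual_counit c.2 *: c.1 = f.
Proof.
apply: dualP => x; rewrite dapp_sum -{2}(mulr1 x) -dual_comul_app.
by apply: eq_bigr => c _; rewrite dappZ mulrC.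
Qed.

Lemma dual_comul1 : teq (dual_comul 1) [:: (1, 1)].
Proof.
by apply: teq_dual => x y; rewrite dual_comul_app big_seq1 !dapp1 counitM.
Qed.

Lemma dual_comulM f g :
  teq (dual_comul (f * g))
      [seq (c.1 * d.1, c.2 * d.2) | c <- dual_comul f, d <- dual_comul g].
Proof.
apply: teq_dual => x y.
rewrite dual_comul_app dappM (comulM x y _ _ (dapp_bil f g)).
rewrite [LHS]big_allpairs_dep [RHS]big_allpairs_dep /=.
transitivity (\sum_(u <- comul x) \sum_(v <- comul y)
    \sum_(c <- dual_comul f) \sum_(d <- dual_comul g)
      (dapp c.1 u.1 * dapp d.1 u.2) * (dapp c.2 v.1 * dapp d.2 v.2)).
  apply: eq_bigr => u _; apply: eq_bigr => v _.
  rewrite -!dual_comul_app mulr_suml; apply: eq_bigr => c _.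
  by rewrite mulr_sumr; apply: eq_bigr => d _; rewrite mulrACA.
transitivity (\sum_(c <- dual_comul f) \sum_(d <- dual_comul g)
    \sum_(u <- comul x) \sum_(v <- comul y)
      (dapp c.1 u.1 * dapp d.1 u.2) * (dapp c.2 v.1 * dapp d.2 v.2)).
  under eq_bigr => u _ do rewrite exchange_big.
  rewrite exchange_big; apply: eq_bigr => c _ /=.
  under eq_bigr => u _ do rewrite exchange_big.
  by rewrite exchange_big; apply: eq_bigr => d _ /=.
apply: eq_bigr => c _; apply: eq_bigr => d _.
rewrite !dappM mulr_suml; apply: eq_bigr => u _.
by rewrite mulr_sumr.
Qed.

Lemma dual_counit1 : dual_counit 1 = 1.
Proof. by rewrite /dual_counit dapp1 counit1. Qed.

Lemma dual_counitM f g : dual_counit (f * g) = dual_counit f * dual_counit g.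
Proof.
by rewrite /dual_counit dappM (comul1 _ _ (dapp_bil f g)) big_seq1.
Qed.

Lemma dual_antipodeE f x : dapp (dual_antipode f) x = dapp f (antipode x).
Proof. by rewrite mkdualE // => a u v; rewrite antipode_linear dapp_linear. Qed.

Lemma dual_antipode_linear : linear dual_antipode.
Proof.
move=> a f g; apply: dualP => x.
by rewrite dappD dappZ !dual_antipodeE dappD dappZ.
Qed.

Lemma dual_antipodel f :
  \sum_(c <- dual_comul f) dual_antipode c.1 * c.2 = (dual_counit f)%:A.
Proof.
apply: dualP => x; rewrite dapp_sum dappZ dapp1.
under eq_bigr => c _ do rewrite dappM.
rewrite exchange_big /=.
transitivity (dapp f (\sum_(u <- comul x) antipode u.1 * u.2)).
  rewrite [RHS]linear_sum; apply: eq_bigr => u _.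
  rewrite -[RHS]/(dapp _ _) -dual_comul_app.
  by apply: eq_bigr => c _; rewrite dual_antipodeE.
by rewrite antipodel /dapp linearZ mulrC.
Qed.

Lemma dual_antipoder f :
  \sum_(c <- dual_comul f) c.1 * dual_antipode c.2 = (dual_counit f)%:A.
Proof.
apply: dualP => x; rewrite dapp_sum dappZ dapp1.
under eq_bigr => c _ do rewrite dappM.
rewrite exchange_big /=.
transitivity (dapp f (\sum_(u <- comul x) u.1 * antipode u.2)).
  rewrite [RHS]linear_sum; apply: eq_bigr => u _.
  rewrite -[RHS]/(dapp _ _) -dual_comul_app.
  by apply: eq_bigr => c _; rewrite dual_antipodeE.
by rewrite antipoder /dapp linearZ mulrC.
Qed.

HB.instance Definition _ := Algebra_isHopf.Build k D
  dual_comul_linear dual_comulA dual_counit_linear dual_counitl dual_counitr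
  dual_comul1 dual_comulM dual_counit1 dual_counitM
  dual_antipode_linear dual_antipodel dual_antipoder.

Lemma dual_cocommutative :
  (forall x y, x * y = y * x) -> cocommutative (dual H).
Proof.
move=> mulC f; apply: teq_dual => x y.
rewrite [in RHS]big_map /= dual_comul_app mulC -dual_comul_app.
by apply: eq_bigr => c _; rewrite mulrC.
Qed.

End Dual.

Record module_algebra (k : fieldType) (K : hopfAlgType k) (A : algType k) :=
  ModuleAlgebra {
    act :> K -> A -> A;
    act_bilinear : bilinear_for *:%R *:%R act;
    act1 : forall a, act 1 a = a;
    actM : forall h h' a, act (h * h') a = act h (act h' a);
    act_mul : forall h a b,
      act h (a * b) = \sum_(c <- comul h) act c.1 a * act c.2 b;
    act_one : forall h, act h 1 = (counit h)%:A
  }.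

Section Sweedler.
Variables (k : fieldType) (K : hopfAlgType k) (A : comAlgType k).
Variable M : module_algebra K A.

(* A linear map out of the n-th tensor power of K is a multilinear map on
   n-tuples. *)
Definition multilinear n (f : n.-tuple K -> A) : Prop :=
  forall (i : 'I_n) (h : n.-tuple K),
    linear (fun x => f [tuple if j == i then x else tnth h j | j < n]).

(* The Sweedler components of h_0 (x) ... (x) h_(n-1) in the tensor power
   coalgebra: all ((h_i(1))_i, (h_i(2))_i). *)
Fixpoint comul_tuple n : n.-tuple K -> seq (n.-tuple K * n.-tuple K) :=
  if n is n'.+1 return n.-tuple K -> seq (n.-tuple K * n.-tuple K)
  then fun h => [seq (cons_tuple c.1 d.1, cons_tuple c.2 d.2)
                   | c <- comul (thead h),
                     d <- comul_tuple (behead_tuple h)]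
  else fun=> [:: ([tuple], [tuple])].

Definition conv n (f g : n.-tuple K -> A) : n.-tuple K -> A :=
  fun h => \sum_(c <- comul_tuple h) f c.1 * g c.2.

Definition conv1 n : n.-tuple K -> A :=
  fun h => (\prod_(x <- h) counit x)%:A.

(* Convolution inverses are unique, so bundling one adds no data. *)
Record Reg n := {
  reg_fun :> n.-tuple K -> A;
  reg_inv : n.-tuple K -> A;
  reg_fun_multilinear : multilinear reg_fun;
  reg_inv_multilinear : multilinear reg_inv;
  reg_funV : conv reg_fun reg_inv =1 @conv1 n;
  reg_Vfun : conv reg_inv reg_fun =1 @conv1 n
}.

(* This is d^i; the three branches are i = 0, i = n + 1 and 1 <= i <= n. *)
Definition face n (i : nat) (f : n.-tuple K -> A) : n.+1.-tuple K -> A :=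
  fun h =>
    if i == 0 then M h`_0 (f [tuple h`_j.+1 | j < n])
    else if i == n.+1 then counit h`_n *: f [tuple h`_j | j < n]
    else f [tuple if (j.+1 < i)%N then h`_j
                  else if j.+1 == i then h`_j * h`_j.+1
                  else h`_j.+1 | j < n].

Definition differential n (f : Reg n) : n.+1.-tuple K -> A :=
  \big[@conv n.+1/@conv1 n.+1]_(i < n.+2)
    face i (if odd i then reg_inv f else reg_fun f).

Definition cocycle n (f : Reg n) : Prop := differential f =1 @conv1 n.+1.

Definition coboundary n : Reg n -> Prop :=
  if n is n'.+1 return Reg n -> Prop
  then fun f => exists g : Reg n', differential g =1 f
  else fun f => f =1 @conv1 0.

(* The quotient ker / Im is the trivial group. *)
Definition sweedler_trivial n : Prop :=
  forall f : Reg n, cocycle f -> coboundary f.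

End Sweedler.

(* C_p ^ n, as an external direct product; ['Z_p] is C_p when 1 < p. *)
Definition cyclic_power (p n : nat) : finGroupType :=
  {dffun forall i : 'I_n, 'Z_p}.

(* Main.v *)
Require Import Defs.
From HB Require Import structures.
From mathcomp Require Import all_boot all_order all_algebra all_fingroup.
From mathcomp Require Import falgebra.
From mathcomp Require Import ring.

(** The idempotents of K make A a C_p^n-graded algebra, and cochains become
    units of the group rings A[G^m], G = C_p^n: d^0 is the coaction and the
    other faces are induced by group homomorphisms. Each coordinate of G
    gives a derivation of the group rings, D_i s = s_i s. For a 2-cocycle x,
    the logarithmic derivatives of x in its second variable have the form
    d^1(w_i) - d^0(w_i). The operators D_i + w_i play the role of lifts, to
    the crossed product of A and K, of the generators of K: their
    commutators and the elements (D_i + w_i)^p - (D_i + w_i) are constant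
    (d^0 = d^1). Constants can be added to the w_i so that the operators
    commute (semisimplicity of D_i, as D_i^p = D_i) and equal their p-th
    powers (Artin-Schreier equations, solvable as the field is algebraically
    closed). Then D_i v = w_i v for a unit v, found by splitting 1 into
    joint eigenvectors of the D_i - w_i and shifting their eigenvalues to 0
    by group elements; x divided by the coboundary of v^-1 no longer depends
    on its second variable, hence is the coboundary of a constant. *)

Set Implicit Arguments.
Unset Strict Implicit.
Unset Printing Implicit Defensive.

Import GRing.Theory.
Local Open Scope ring_scope.

(** * Operators D + w for a derivation D in characteristic p *)

(** The pairing [m] joins three different spaces, so that the rule covers products twisted
    differently on each factor as well as the action of operators on functions. The induction is
    Pascal's rule. *)
Lemma iter_leibniz (U V : Type) (W : zmodType) (m : U -> V -> W)
    (P : U -> U) (Q : V -> V) (S : {additive W -> W}) :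
    (forall x y, S (m x y) = m (P x) y + m x (Q y)) ->
  forall n x y, iter n S (m x y) =
    \sum_(i < n.+1) m (iter i P x) (iter (n - i) Q y) *+ 'C(n, i).
Proof.
move=> SE; elim=> [|n IHn] x y; first by rewrite big_ord1 bin0 mulr1n.
have itD q : {morph iter q S : u v / u + v}.
  by elim: q => [|q IHq] u v //; rewrite !iterS IHq raddfD.
rewrite iterSr SE itD !IHn.
rewrite [RHS]big_ord_recl /= ?subn0 bin0 mulr1n.
rewrite [X in _ + X = _]big_ord_recl /= ?subn0 bin0 mulr1n addrCA -iterSr.
congr (_ + _).
under [RHS]eq_bigr => i _ do rewrite subSS binS mulrnDr.
rewrite big_split /= addrC; congr (_ + _); last first.
  by apply: eq_bigr => i _; rewrite -iterSr.
rewrite [RHS]big_ord_recr /= bin_small // mulr0n addr0.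
by apply: eq_bigr => i _; rewrite -iterSr /bump add1n -subSn // subSS.
Qed.

(** All binomial coefficients but the two outer ones are divisible by p. *)
Lemma iter_leibniz_pchar (U V : Type) (W : zmodType) (m : U -> V -> W)
    (P : U -> U) (Q : V -> V) (S : {additive W -> W}) (p : nat) :
    (forall x y, S (m x y) = m (P x) y + m x (Q y)) ->
    prime p -> (forall w : W, w *+ p = 0) ->
  forall x y, iter p S (m x y) = m (iter p P x) y + m x (iter p Q y).
Proof.
move=> SE p_pr Wp x y; rewrite (iter_leibniz SE).
case: p p_pr Wp => // p p_pr Wp.
rewrite big_ord_recl big_ord_recr /= ?subn0 bin0 !mulr1n /bump add1n subnn binn.
rewrite mulr1n big1 ?add0r 1?addrC // => i _.
have /dvdnP[q ->] : (p.+1 %| 'C(p.+1, bump 0 i))%N.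
  by apply: prime_dvd_bin => //; rewrite /bump add1n /= ltnS.
by rewrite mulrnA Wp.
Qed.

Definition derivation (R : nzRingType) (D : R -> R) : Prop :=
  forall x y, D (x * y) = D x * y + x * D y.

Lemma derivation1 (R : nzRingType) (D : {additive R -> R}) :
  derivation D -> D 1 = 0.
Proof.
move=> derD; apply: (addrI (D 1)).
by rewrite addr0 -{3}[1]mulr1 derD mulr1 mul1r.
Qed.

Section Twist.
Variables (p : nat) (R : comNzRingType).
Hypothesis charp : p \in [pchar R].

Definition twist (D : R -> R) (w x : R) : R := D x + w * x.

(** The function by which [(D + w)^p] differs from [D^p], see [iter_twist]; Jacobson's formula
    writes it as [w^p + D^(p-1) w]. If [D^p = D], the equation [potential D w = w] says that [D + w]
    equals its p-th power. *)
Definition potential (D : R -> R) (w : R) : R := iter p (twist D w) 1.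

Variable D : {additive R -> R}.
Hypothesis derD : derivation D.

Lemma twist_is_additive w : zmod_morphism (twist D w).
Proof. by move=> x y; rewrite /twist raddfB; ring. Qed.

HB.instance Definition _ w :=
  GRing.isZmodMorphism.Build R R (twist D w) (twist_is_additive w).

Lemma derivationX x n : D (x ^+ n) = (x ^+ n.-1 * D x) *+ n.
Proof.
elim: n => [|n IHn]; first by rewrite derivation1.
rewrite exprS derD IHn mulrnAr mulrS mulrC; congr (_ + _).
by case: n {IHn} => [|n]; rewrite ?mulr0n //= exprS mulrA.
Qed.

Lemma twistDM w w' x y :
  twist D (w + w') (x * y) = twist D w x * y + x * twist D w' y.
Proof. by rewrite /twist derD; ring. Qed.

Lemma iter_twistDM w w' x y :
  iter p (twist D (w + w')) (x * y) =
  iter p (twist D w) x * y + x * iter p (twist D w') y.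
Proof.
apply: (iter_leibniz_pchar (m := *%R) (twistDM w w')) (pcharf_prime charp) _ x y.
by move=> z; rewrite -mulr_natr (pcharf0 charp) mulr0.
Qed.

Lemma potentialD w w' : potential D (w + w') = potential D w + potential D w'.
Proof. by have := iter_twistDM w w' 1 1; rewrite !mulr1 mul1r. Qed.

Lemma twist0 : twist D 0 =1 D.
Proof. by move=> x; rewrite /twist mul0r addr0. Qed.

Lemma iter_twist w x : iter p (twist D w) x = iter p D x + x * potential D w.
Proof.
have := iter_twistDM 0 w x 1.
by rewrite add0r !mulr1 => ->; rewrite (eq_iter twist0).
Qed.

Lemma iter_der1 n : (0 < n)%N -> iter n D 1 = 0.
Proof.
case: n => // n _; rewrite iterSr derivation1 //.
by elim: n => //= n ->; rewrite raddf0.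
Qed.

Lemma potential0 : potential D 0 = 0.
Proof.
rewrite /potential (eq_iter twist0) iter_der1 //.
exact: prime_gt0 (pcharf_prime charp).
Qed.

Lemma potentialN w : potential D (- w) = - potential D w.
Proof. by apply/eqP; rewrite -addr_eq0 -potentialD addNr potential0. Qed.

Lemma potential_const a : D a = 0 -> potential D a = a ^+ p.
Proof.
move=> Da; rewrite /potential; elim: p => //= n ->.
by rewrite /twist derivationX Da mulr0 mul0rn add0r exprS.
Qed.

(* [s^-1 D s = D + l] for the logarithmic derivative [l] of the unit [s]. *)
Lemma potential_dlog s s' l : s * s' = 1 -> D s = l * s ->
  iter p D s = D s -> potential D l = l.
Proof.
move=> ss' Ds Dps.
have it n : s * iter n (twist D l) 1 = iter n D s.
  elim: n => [|n IHn]; first by rewrite mulr1.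
  by rewrite !iterS -IHn /twist derD Ds; ring.
have: s * potential D l = s * l by rewrite it Dps Ds mulrC.
move/(congr1 ( *%R s')); rewrite !mulrA [s' * s]mulrC ss'.
by rewrite !mul1r.
Qed.

(* The operator [x + y D'] is stable under the commutator with [twist D w];
   Leibniz' rule is applied to its action on functions. *)
Lemma der_potential (D' : {additive R -> R}) w : derivation D' ->
  (forall x, D (D' x) = D' (D x)) ->
  D' (potential D w) = iter p.-1 D (D' w).
Proof.
move=> derD' commD.
pose P (z : R * R) := (D z.1 - z.2 * D' w, D z.2).
pose m (z : R * R) F := z.1 * F + z.2 * D' F.
have mE z F : twist D w (m z F) = m (P z) F + m z (twist D w F).
  rewrite /twist /m /P /= !raddfD /= !derD derD' commD; ring.
(* As an operator, [(0, 1)] is [D']; its commutator with [twist D w] is multiplication by [- D' w],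
   on which further commutators act through [D]. *)
have itP n : iter n.+1 P (0, 1) = (- iter n D (D' w), 0).
  elim: n => [|n IHn]; first by rewrite /P /= raddf0 derivation1 // mul1r sub0r.
  by rewrite iterS IHn /P /= raddf0 mul0r subr0 raddfN.
have p_gt0 := prime_gt0 (pcharf_prime charp).
have Rp (z : R) : z *+ p = 0 by rewrite -mulr_natr (pcharf0 charp) mulr0.
have := iter_leibniz_pchar mE (pcharf_prime charp) Rp (0, 1) 1.
rewrite -{2}(prednK p_gt0) itP /m /= (derivation1 derD').
rewrite !mulr0 !mul0r mulr1 mul1r !add0r addr0 -/(potential D w).
have it0 n : iter n (twist D w) 0 = 0 by elim: n => //= n ->; rewrite raddf0.
by rewrite it0 addrC => /esym/subr0_eq.
Qed.
End Twist.

(** * Eigenvectors and Artin-Schreier equations *)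

Section PowerSums.
Variables (k : fieldType) (p : nat).
Hypothesis charp : p \in [pchar k].

Lemma expr_nat_pchar c : c%:R ^+ p = c%:R :> k.
Proof. exact: pFrobenius_aut_nat charp c. Qed.

Lemma natr_pchar_eq0 c : (c < p)%N -> (c%:R == 0 :> k) = (c == 0%N).
Proof.
move=> cp; rewrite -(dvdn_pcharf charp); case: c cp => [|c] cp; first by rewrite dvdn0.
by rewrite gtnNdvd.
Qed.

(** The differences of consecutive (m+1)-st powers telescope to [p^(m+1) = 0]. Expanded, they give
    m+1 times this sum plus sums of lower powers, and m+1 is invertible. *)
Lemma sum_pow_small m : (m < p.-1)%N -> \sum_(c < p) c%:R ^+ m = 0 :> k.
Proof.
have p_gt0 := prime_gt0 (pcharf_prime charp).
elim/ltn_ind: m => m IHm ltmp.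
have: \sum_(0 <= c < p) (c.+1%:R ^+ m.+1 - c%:R ^+ m.+1) = 0 :> k.
  by rewrite telescope_sumr // (pcharf0 charp) expr0n subrr.
rewrite big_mkord.
under eq_bigr => c _ do
  rewrite -addn1 natrD exprD1n big_ord_recr /= binn mulr1n addrK.
rewrite exchange_big big_ord_recr /= big1 => [|j _]; last first.
  by rewrite sumrMnl IHm ?mul0rn // (ltn_trans _ ltmp).
rewrite add0r sumrMnl binSn -mulr_natr => /eqP; rewrite mulf_eq0.
by rewrite natr_pchar_eq0 ?orbF => [/eqP //|]; rewrite -ltn_predRL.
Qed.

(** By Fermat each of the p - 1 nonzero [c] contributes 1. *)
Lemma sum_pow_pred : \sum_(c < p) c%:R ^+ p.-1 = -1 :> k.
Proof.
have pr := pcharf_prime charp.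
case: p charp (pr) sum_pow_small expr_nat_pchar natr_pchar_eq0
  => // q chq pr_q _ fermat nat0.
rewrite big_ord_recl /= expr0n.
have -> : (q == 0)%N = false by case: (q) pr_q.
rewrite add0r (eq_bigr (fun=> 1)) => [|i _]; last first.
  apply: (mulfI (x := (bump 0 i)%:R)); first by rewrite nat0 // /bump add1n ltnS.
  by rewrite mulr1 -exprS fermat.
rewrite sumr_const card_ord; apply/eqP.
by rewrite -addr_eq0 -mulrSr (pcharf0 chq).
Qed.

Variable V : lmodType k.
Variable T : {linear V -> V}.

(** This is [1 - (T - c)^(p-1)] applied to [x], the power being written as [(T^p - c^p) / (T - c)]:
    the projector onto the c-eigenspace when [T^p = T]. *)
Definition eigencomp (c : nat) (x : V) : V :=
  x - \sum_(j < p) c%:R ^+ (p.-1 - j) *: iter j T x.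

(** The factor [T - c] makes the geometric sum telescope to [T^p - c^p], which is [T - c] on [x]. *)
Lemma eigencompE c x : iter p T x = T x -> T (eigencomp c x) = c%:R *: eigencomp c x.
Proof.
move=> Tp.
have p_gt0 := prime_gt0 (pcharf_prime charp).
pose t j := (c%:R ^+ (p - j) : k) *: iter j T x.
suff : T (\sum_(j < p) c%:R ^+ (p.-1 - j) *: iter j T x) -
    c%:R *: \sum_(j < p) c%:R ^+ (p.-1 - j) *: iter j T x = T x - c%:R *: x.
  move/eqP; rewrite subr_eq => /eqP e.
  by rewrite /eigencomp raddfB /= e scalerBr opprD opprB addrA [T x + _]addrC subrK.
rewrite raddf_sum scaler_sumr -sumrB.
transitivity (\sum_(0 <= j < p) (t j.+1 - t j)).
  rewrite big_mkord; apply: eq_bigr => j _; rewrite /t /= (linearZ_LR T) scalerA -exprS.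
  by rewrite -subn1 -subnDA add1n subnSK.
by rewrite telescope_sumr // /t subnn subn0 expr0 scale1r Tp expr_nat_pchar.
Qed.

(** Summing over [c] leaves only the power sum of exponent p - 1, which belongs to [j = 0] and
    equals -1. *)
Lemma sum_eigencomp x : \sum_(c < p) eigencomp c x = x.
Proof.
have p_gt0 := prime_gt0 (pcharf_prime charp).
rewrite sumrB exchange_big /=.
under [X in _ - X]eq_bigr => j _ do rewrite -scaler_suml.
rewrite sumr_const card_ord -scaler_nat (pcharf0 charp) scale0r add0r.
case: p charp p_gt0 sum_pow_small sum_pow_pred => // q _ _ small pred.
rewrite big_ord_recl /= subn0 pred big1 => [|j _]; last first.
  by rewrite small ?scale0r //= ltn_subrL; case: (q) j => // -[].
by rewrite addr0 scaleN1r opprK.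
Qed.

(** A polynomial in [T] preserves the kernel of an operator commuting with [T]. *)
Lemma eigencomp_ker (U : {linear V -> V}) c x :
  (forall y, U (T y) = T (U y)) -> U x = 0 -> U (eigencomp c x) = 0.
Proof.
move=> UT Ux; have Uit j : U (iter j T x) = 0.
  suff -> : U (iter j T x) = iter j T (U x).
    by rewrite Ux; elim: j => //= j ->; rewrite raddf0.
  by elim: j => //= j IHj; rewrite UT IHj.
rewrite /eigencomp linearB Ux sub0r linear_sum big1 ?oppr0 //= => j _.
by rewrite (linearZ_LR U) Uit scaler0.
Qed.

End PowerSums.

Section ArtinSchreier.
Variables (k : closedFieldType) (p : nat) (R : comFalgType k).
Hypothesis charp : p \in [pchar k].

(** Otherwise the first [\dim {:R} + 1] terms would be linearly independent. *)
Lemma seq_span_relation (e : nat -> R) :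
  exists N (t : nat -> k), e N = \sum_(i < N) t i *: e i.
Proof.
suff /existsP[N eN] : [exists N : 'I_(\dim {:R}).+1, e N \in <<mkseq e N>>%VS].
  pose X := [tuple of mkseq e N].
  exists N, (fun j => if insub j is Some i then coord X i (e N) else 0).
  rewrite {1}(coord_span (X := X) eN); apply: eq_bigr => i _.
  by rewrite insubT // => lt_iN; rewrite nth_mkseq // (_ : Sub _ _ = i) //; apply: val_inj.
apply/existsPn => notin.
have free_e n : (n <= (\dim {:R}).+1)%N -> free (rev (mkseq e n)).
  elim: n => [|n IHn] ltn; first by rewrite nil_free.
  rewrite mkseqS rev_rcons free_cons IHn 1?ltnW // andbT.
  rewrite (eq_span (mem_rev _)); exact: (notin (Ordinal ltn)).
have := free_e _ (leqnn _); rewrite /free size_rev size_mkseq => /eqP dimE.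
by have := dimvS (subvf <<rev (mkseq e (\dim {:R}).+1)>>%VS); rewrite dimE ltnn.
Qed.

Lemma frobeniusZD (s : k) (x y : R) :
  (s *: x + y) ^+ p = s ^+ p *: x ^+ p + y ^+ p.
Proof.
have chR : p \in [pchar R] by rewrite pchar_lalg.
by rewrite -!(pFrobenius_autE chR) rmorphD /= !pFrobenius_autE exprZn.
Qed.

Lemma frobenius_sumZ (I : Type) (r : seq I) (s : I -> k) (x : I -> R) :
  (\sum_(i <- r) s i *: x i) ^+ p = \sum_(i <- r) s i ^+ p *: x i ^+ p.
Proof.
elim: r => [|i r IHr]; last by rewrite !big_cons frobeniusZD IHr.
by rewrite !big_nil expr0n; case: p (pcharf_prime charp).
Qed.

(* Given [c ^+ (p ^ N) = \sum_(i < N) t i *: c ^+ (p ^ i)], the coefficients of [a]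
   are polynomials in one unknown [l], the multiple of this relation
   that is used; what remains is an equation [P ^+ p = 'X] in [l], which is not
   constant because its derivative is [-1]. *)
Lemma artin_schreier (c : R) : exists N (s : nat -> k),
  let a := \sum_(i < N) s i *: c ^+ (p ^ i) in a ^+ p - a = - c.
Proof.
have [N [t tE]] := seq_span_relation (fun i => c ^+ (p ^ i)).
(* Comparing coefficients, each [s i] must be the p-th power of the previous one plus [l * t i]; the
   exponent [p ^ N] leaves the condition [r N ^+ p = l]. *)
pose r := fix r i : {poly k} :=
  if i is i'.+1 then r i' ^+ p + t i' *: 'X else 1.
have rE i : r i.+1 = r i ^+ p + t i *: 'X by [].
have /closed_rootP[l] : size (r N ^+ p - 'X) != 1%N.
  apply/eqP => /eqP/size_poly1P[b _ /(congr1 (@deriv _))].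
  rewrite derivB derivX derivC deriv_exp /=.
  have chP : p \in [pchar {poly k}] by rewrite pchar_poly.
  rewrite -mulr_natr (pcharf0 chP) mulr0 sub0r => /eqP.
  by rewrite oppr_eq0 oner_eq0.
rewrite /root !hornerE subr_eq0 => /eqP rl.
exists N, (fun i => (r i.+1).[l]); cbv zeta.
rewrite frobenius_sumZ.
pose f i := (r i).[l] ^+ p *: c ^+ (p ^ i).
have aE : \sum_(i < N) (r i.+1).[l] *: c ^+ (p ^ i) =
    \sum_(i < N) f i + l *: c ^+ (p ^ N).
  rewrite tE scaler_sumr -big_split; apply: eq_bigr => i _.
  by rewrite rE !hornerE scalerDl scalerA [l * _]mulrC.
rewrite aE opprD addrA -sumrB.
transitivity (\sum_(0 <= i < N) (f i.+1 - f i) - l *: c ^+ (p ^ N)).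
  rewrite big_mkord; congr (_ - _); apply: eq_bigr => i _.
  by rewrite /f expnSr exprM.
rewrite telescope_sumr // /f rl hornerE expr1n scale1r expn0 expr1.
by rewrite addrAC subrr add0r.
Qed.
End ArtinSchreier.

(** * Flattening and integrating connections *)

Lemma twist_is_scalable (k : fieldType) (R : comAlgType k)
    (D : {linear R -> R}) (w : R) : scalable (twist D w).
Proof. by move=> a x; rewrite /twist linearZ /= scalerDr scalerAr. Qed.

HB.instance Definition _ (k : fieldType) (R : comAlgType k)
    (D : {linear R -> R}) (w : R) :=
  GRing.isScalable.Build k R R *:%R (twist D w) (twist_is_scalable D w).

Section Connection.
Variables (k : closedFieldType) (p : nat).
Hypothesis charp : p \in [pchar k].
Variables (R : comFalgType k) (n : nat) (D : 'I_n -> {linear R -> R}).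
Hypothesis derD : forall i, derivation (D i).
Hypothesis commD : forall i j x, D i (D j x) = D j (D i x).
Hypothesis iterD : forall i x, iter p (D i) x = D i x.

Let charR : p \in [pchar R]. Proof. by rewrite pchar_lalg. Qed.

(** * Correcting the connection forms by constants *)

Section Gauge.
Variables (R2 : comAlgType k) (E : 'I_n -> {additive R2 -> R2}).
Hypothesis derE : forall i, derivation (E i).
Variables d0 d1 : {lrmorphism R -> R2}.
Hypothesis d0D : forall i x, d0 (D i x) = E i (d0 x).
Hypothesis d1D : forall i x, d1 (D i x) = E i (d1 x).
Variable l : 'I_n -> R2.
Hypothesis flat_l : forall i j, E i (l j) = E j (l i).
Hypothesis potential_l : forall i, potential p (E i) (l i) = l i.

Let charR2 : p \in [pchar R2]. Proof. by rewrite pchar_lalg. Qed.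

(** The constants: primitives of [l i] may be changed by elements of this equalizer. *)
Let S x := d1 x = d0 x.

Let SDer i x : S x -> S (D i x).
Proof. by rewrite /S d0D d1D => ->. Qed.

Let SDern i m x : S x -> S (iter m (D i) x).
Proof. by move=> Sx; elim: m => //= m; apply: SDer. Qed.

Lemma rmorph_potential (d : {lrmorphism R -> R2}) i x :
  (forall y, d (D i y) = E i (d y)) ->
  d (potential p (D i) x) = potential p (E i) (d x).
Proof.
move=> dD; rewrite /potential -[in RHS](rmorph1 d).
elim: p => //= m IHm; rewrite {1}/twist rmorphD rmorphM /=.
by rewrite dD IHm.
Qed.

Let primitive i x := l i = d1 x - d0 x.

Let primitiveD i x s : primitive i x -> S s -> primitive i (x + s).
Proof. by rewrite /primitive /S !raddfD /= => -> ->; ring. Qed.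

(** [D i y - D j x] is the commutator of [D i + x] and [D j + y]; its images under [d1] and [d0]
    differ by [E i (l j) - E j (l i) = 0]. *)
Let curvature i j x y : primitive i x -> primitive j y -> S (D i y - D j x).
Proof.
rewrite /primitive /S => lx ly; rewrite !raddfB /= !d0D !d1D.
have := flat_l i j; rewrite lx ly !raddfB /= => /eqP.
rewrite subr_eq => /eqP ->; ring.
Qed.

(** Potentials are additive, so passing from [d0 x] to [d1 x = l i + d0 x] adds [l i] to both
    terms. *)
Let pcurvature i x : primitive i x -> S (potential p (D i) x - x).
Proof.
rewrite /primitive /S => lx; rewrite !raddfB /= !rmorph_potential //.
have -> : d1 x = l i + d0 x by rewrite lx subrK.
by rewrite (potentialD charR2) // potential_l; ring.
Qed.

Let flat m (w : 'I_n -> R) := (forall i j : 'I_n, (i < m)%N -> (j < m)%N ->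
  D i (w j) = D j (w i)) /\
  (forall i : 'I_n, (i < m)%N -> potential p (D i) (w i) = w i).

Lemma iter_lin0 i m : iter m (D i) 0 = 0.
Proof. by elim: m => //= m ->; rewrite raddf0. Qed.

Lemma iter_lin_comm i j m x : D i (iter m (D j) x) = iter m (D j) (D i x).
Proof. by elim: m => //= m IHm; rewrite commD IHm. Qed.

Lemma iter_linB i m x y : iter m (D i) (x - y) = iter m (D i) x - iter m (D i) y.
Proof. by elim: m => //= m ->; rewrite raddfB. Qed.

(** The commutators with the operators of index below [m] are killed one after the other. The
    commutator [b] with the t-th one is constant, and the (p-1)-st power of [D T] fixes it because
    [D T] equals its p-th power and [w T] is its own potential. *)
Let flatten_commutators m w (a : 'I_n) : (forall i, primitive i (w i)) ->
  flat m w -> (m <= a)%N -> exists2 x, primitive a x &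
  forall i : 'I_n, (i < m)%N -> D i x = D a (w i).
Proof.
move=> pw [fw ppw] ma.
have p_pr := pcharf_prime charp.
have: (m <= m)%N by []; move: {1 3}m; elim=> [|t IHt] tm; first by exists (w a).
have [x px Dx] := IHt (ltnW tm).
have tn : (t < n)%N by rewrite (leq_trans tm) // ltnW // (leq_ltn_trans ma).
pose T := Ordinal tn; pose b := D T x - D a (w T).
have Db : iter p.-1 (D T) b = b.
  rewrite iter_linB -iterSr prednK ?prime_gt0 // iterD.
  by rewrite -(der_potential charR (derD T) _ (derD a) (commD T a)) /= ppw.
(* As [D^p.-1 b = b], subtracting [D^p.-2 b] kills the commutator [b]. *)
exists (x - iter p.-2 (D T) b).
  have Sb : S (iter p.-2 (D T) b) by apply: SDern; apply: curvature.
  by apply: (primitiveD px); rewrite /S !raddfN /= Sb.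
(* For [i < t], the flatness of [w] and the earlier commutators give [D i b = 0], so the correction
   leaves [D i x] unchanged. *)
move=> i; rewrite ltnS leq_eqVlt => /orP[/eqP it | it]; last first.
  rewrite raddfB /= Dx // iter_lin_comm /b raddfB /= commD Dx //.
  rewrite (commD i a) (fw i T) ?(ltn_trans it) // (commD T a) subrr.
  by rewrite iter_lin0 subr0.
have -> : i = T by apply: val_inj.
rewrite raddfB /= -iterS; case: (p) p_pr Db => [|[|q]] // _ /= ->.
by rewrite /b opprB addrC subrK.
Qed.

(** The forms are corrected one by one. Once [x] commutes with the earlier ones, its defect [c] is
    removed by adding [y] with [y^p - y = - c], since the potential of [x + y] is that of [x] plus
    [y^p]. *)
Lemma gauge : (exists w, forall i, l i = d1 (w i) - d0 (w i)) ->
  exists w, [/\ forall i, l i = d1 (w i) - d0 (w i),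
                forall i j, D i (w j) = D j (w i)
              & forall i, potential p (D i) (w i) = w i].
Proof.
case=> w0 pw0.
suff /(_ n (leqnn n))[w [pw [fw ppw]]] : forall m, (m <= n)%N ->
    exists w, (forall i, primitive i (w i)) /\ flat m w.
  by exists w; split=> // [i j|i]; [apply: fw | apply: ppw].
elim=> [|m IHm] mn; first by exists w0; split.
have [w [pw fw]] := IHm (ltnW mn).
pose a := Ordinal mn.
have [x px Dx] := flatten_commutators pw fw (leqnn m : (m <= a)%N).
pose c := potential p (D a) x - x.
have Sc : S c by apply: pcurvature.
have Dc (i : 'I_n) : (i < m.+1)%N -> D i c = 0.
  move=> im; rewrite raddfB /= (der_potential charR (derD a) _ (derD i) (commD a i)) /=.
  (* For [i <= a] the element [D i x] is in the image of [D a], where the (p-1)-st power of [D a] is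
     the identity. *)
  have -> : D i x = D a (if (i < m)%N then w i else x).
    case: ltnP => [/Dx // | mi]; congr (D _ x).
    by apply/val_inj/eqP; rewrite eqn_leq mi andbT -ltnS.
  by rewrite -iterSr prednK ?prime_gt0 ?(pcharf_prime charp) // iterD subrr.
have [N [s sE]] := artin_schreier charp c.
set y := \sum_(j < N) _ in sE.
(* [y] is a combination of powers of [c], so like [c] it is constant and killed by the first
   operators. *)
have Sy : S y.
  rewrite /S /y !linear_sum; apply: eq_bigr => j _.
  by rewrite !linearZ !rmorphXn /= Sc.
have Dy (i : 'I_n) : (i < m.+1)%N -> D i y = 0.
  move=> im; rewrite linear_sum big1 // => j _.
  by rewrite linearZ /= (derivationX (derD i)) /= Dc // mulr0 mul0rn scaler0.
exists (fun i => if i == a then x + y else w i); split.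
  by move=> i; case: eqP => [->|_]; [apply: primitiveD | ].
have lt_or (i : 'I_n) : (i < m.+1)%N -> i = a \/ (i != a /\ (i < m)%N).
  rewrite ltnS leq_eqVlt; case: eqVneq => [ia _|ia /= im]; first by left; apply: val_inj.
  by right; split=> //; apply: contraNneq ia => ->.
split=> [i j im jm | i im].
  case: (lt_or i im) (lt_or j jm) => [->|[/negPf-> im']] [->|[/negPf-> jm']] //; rewrite ?eqxx.
  - by rewrite raddfD /= (Dy j) // addr0 Dx.
  - by rewrite raddfD /= (Dy i) // addr0 Dx.
  - by apply: (proj1 fw).
case: (lt_or i im) => [->|[/negPf-> im']]; last by apply: (proj2 fw).
rewrite eqxx (potentialD charR (derD a)) (potential_const p (derD a) (Dy a (leqnn _))).
move/eqP: sE; rewrite subr_eq => /eqP ->.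
by rewrite /c; ring.
Qed.

End Gauge.

(** * Solving [D i v = w i * v] *)

Section Integration.
Variables (B : comNzRingType) (eps : {rmorphism R -> B}) (h : 'I_n -> R).
Hypothesis Dh : forall i j, D i (h j) = - (h j *+ (i == j)).
Hypothesis eps_h : forall i, eps (h i) = 1.
Variable w : 'I_n -> R.
Hypothesis flat_w : forall i j, D i (w j) = D j (w i).
Hypothesis potential_w : forall i, potential p (D i) (w i) = w i.

Let nabla i := twist (D i) (- w i).

Let nablaC i j x : nabla i (nabla j x) = nabla j (nabla i x).
Proof.
by rewrite /nabla /twist !raddfD /= !derD !raddfN /= flat_w commD; ring.
Qed.

Let iter_nabla i x : iter p (nabla i) x = nabla i x.
Proof.
rewrite (iter_twist charR (derD i)) /= iterD (potentialN charR (derD i)) potential_w.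
by rewrite /nabla /twist mulrC.
Qed.

Let nabla_hX i j c x :
  nabla i (h j ^+ c * x) = h j ^+ c * (nabla i x - x *+ (c * (i == j))).
Proof.
rewrite /nabla /twist derD (derivationX (derD i)) /= Dh.
have -> : h j ^+ c.-1 * - (h j *+ (i == j)) *+ c =
    - (h j ^+ c) *+ (c * (i == j)).
  case: c => [|c]; first by rewrite mul0n.
  by rewrite /= mulrN mulrnAr -exprSr -mulNrn -mulrnA mulnC.
by rewrite mulrnAl mulrBr mulrDr mulrnAr mulNr -mulNrn; ring.
Qed.

(** One operator is treated at a time: [v] is split into eigenvectors of [nabla a], and the factor
    [h a ^+ c] moves the eigenvalue [c] to 0. As [eps (h a) = 1], the value of [eps] stays 1; the
    operators treated before commute with [nabla a] and kill [h a] under [D], so they still kill the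
    result. *)
Lemma integrate : exists v, eps v = 1 /\ forall i, D i v = w i * v.
Proof.
suff /(_ n (leqnn n))[v [v1 vE]] : forall m, (m <= n)%N ->
    exists v, eps v = 1 /\ forall i : 'I_n, (i < m)%N -> nabla i v = 0.
  exists v; split=> // i; apply/eqP; rewrite -subr_eq0 -mulNr.
  by have := vE i (ltn_ord i); rewrite /nabla /twist => ->.
elim=> [|m IHm] mn; first by exists 1; rewrite rmorph1.
have [v [v1 vE]] := IHm (ltnW mn); pose a := Ordinal mn.
pose e c := eigencomp p (nabla a) c v.
exists (\sum_(c < p) h a ^+ c * e c); split.
  rewrite rmorph_sum -v1 -[in RHS](sum_eigencomp charp (nabla a) v) rmorph_sum.
  by apply: eq_bigr => c _; rewrite rmorphM rmorphXn eps_h expr1n mul1r.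
move=> i im; rewrite [LHS](raddf_sum (twist (D i) (- w i))) big1 //= => c _.
rewrite -/(nabla i _) nabla_hX.
have [->|nia] := eqVneq i a.
  have -> : nabla a (e c) = c%:R *: e c.
    exact: (eigencompE charp c (iter_nabla a v)).
  by rewrite muln1 scaler_nat subrr mulr0.
have im' : (i < m)%N.
  by move: im; rewrite ltnS leq_eqVlt => /orP[/eqP ia|//]; case/eqP: nia; apply: val_inj.
have -> : nabla i (e c) = 0.
  exact: (eigencomp_ker p (U := twist (D i) (- w i)) c (nablaC i a) (vE i im')).
by rewrite muln0 subr0 mulr0.
Qed.
End Integration.
End Connection.

(** * Group rings of finite abelian groups *)

HB.instance Definition _ (H H' : finZmodType) := GRing.Zmodule.on (H * H')%type.

(** With [fst], [snd], [idfun] and [\0] this builds all homomorphisms that induce faces, and their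
    additivity is inferred. *)
Definition pairf (T U V : Type) (f : T -> U) (g : T -> V) x := (f x, g x).

Lemma pairf_is_additive (T U V : zmodType) (f : {additive T -> U})
  (g : {additive T -> V}) : zmod_morphism (pairf f g).
Proof. by move=> x y; rewrite /pairf !raddfB. Qed.

HB.instance Definition _ (T U V : zmodType) (f : {additive T -> U})
    (g : {additive T -> V}) :=
  GRing.isZmodMorphism.Build T (U * V)%type (pairf f g) (pairf_is_additive f g).

(** The group ring A[H] for [H] written additively; [mono a s] below is [a] times the group element
    [s]. *)
Definition gring (A : Type) (H : finType) : Type := {ffun H -> A}.

Section GroupRing.
Variables (k : fieldType) (A : comFalgType k) (H : finZmodType).

HB.instance Definition _ := Vector.on (gring A H).

Local Notation AH := (gring A H).
Implicit Types (x y z : AH) (s t u : H) (a b : A).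

Definition gmul x y : AH := [ffun s => \sum_t x t * y (s - t)].
Definition mono a s : AH := [ffun t => if t == s then a else 0].

Lemma gmulA : associative gmul.
Proof.
move=> x y z; apply/ffunP=> s; rewrite !ffunE.
under eq_bigr => t _ do rewrite ffunE mulr_sumr.
under [RHS]eq_bigr => t _ do rewrite ffunE mulr_suml.
rewrite [RHS]exchange_big /=; apply: eq_bigr => t _.
rewrite [RHS](reindex_inj (addIr t)) /=; apply: eq_bigr => u _.
by rewrite addrK mulrA opprD addrCA addrC.
Qed.

Lemma gmulC : commutative gmul.
Proof.
move=> x y; apply/ffunP=> s; rewrite !ffunE.
rewrite (reindex_inj (inv_inj (subKr s))) /=; apply: eq_bigr => t _.
by rewrite subKr mulrC.
Qed.

Lemma gmul1 : left_id (mono 1 0) gmul.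
Proof.
move=> x; apply/ffunP=> s; rewrite ffunE (bigD1 0) //= ffunE eqxx mul1r subr0.
by rewrite big1 ?addr0 // => t nt0; rewrite ffunE (negPf nt0) mul0r.
Qed.

Lemma gmulDl : left_distributive gmul +%R.
Proof.
move=> x y z; apply/ffunP=> s; rewrite !ffunE -big_split.
by apply: eq_bigr => t _; rewrite ffunE mulrDl.
Qed.

Lemma gone_neq0 : mono 1 0 != 0.
Proof. by apply/eqP=> /ffunP/(_ 0); rewrite !ffunE eqxx => /eqP; rewrite oner_eq0. Qed.

HB.instance Definition _ := GRing.Zmodule_isComNzRing.Build AH
  gmulA gmulC gmul1 gmulDl gone_neq0.

Lemma gmulE x y s : (x * y) s = \sum_t x t * y (s - t).
Proof. by rewrite ffunE. Qed.

Lemma goneE s : @GRing.one AH s = if s == 0 then 1 else 0.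
Proof. by rewrite ffunE. Qed.

Lemma gscaleE (c : k) x s : (c *: x) s = c *: x s.
Proof. by rewrite ffunE. Qed.

Lemma gscalerAl (c : k) x y : c *: (x * y) = (c *: x) * y.
Proof.
apply/ffunP=> s; rewrite gscaleE !gmulE scaler_sumr.
by apply: eq_bigr => t _; rewrite gscaleE scalerAl.
Qed.

HB.instance Definition _ := GRing.Lmodule_isLalgebra.Build k AH gscalerAl.

Lemma gscalerAr (c : k) x y : c *: (x * y) = x * (c *: y).
Proof. by rewrite mulrC gscalerAl mulrC. Qed.

HB.instance Definition _ := GRing.Lalgebra_isAlgebra.Build k AH gscalerAr.

HB.instance Definition _ := Algebra_isFalgebra.Build k AH.

Lemma gsumE (I : Type) (r : seq I) (P : pred I) (F : I -> AH) s :
  (\sum_(i <- r | P i) F i) s = \sum_(i <- r | P i) F i s.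
Proof. by elim/big_rec2: _ => [|i v x _ <-]; rewrite ffunE. Qed.

Lemma gring_basis x : x = \sum_s mono (x s) s.
Proof.
apply/ffunP=> t; rewrite gsumE (bigD1 t) //= ffunE eqxx big1 ?addr0 // => s nst.
by rewrite ffunE eq_sym (negPf nst).
Qed.

Lemma monoM a b s t : mono a s * mono b t = mono (a * b) (s + t).
Proof.
apply/ffunP=> u; rewrite gmulE (bigD1 s) //= !ffunE eqxx subr_eq [s + t]addrC.
rewrite big1 ?addr0 => [|v nvs]; last by rewrite ffunE (negPf nvs) mul0r.
by case: eqP; rewrite ?mulr0.
Qed.

Lemma monoX a s i : mono a s ^+ i = mono (a ^+ i) (s *+ i).
Proof. by elim: i => // i IHi; rewrite !exprS mulrS IHi monoM. Qed.

Section Derivation.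
Variable chi : H -> k.
Definition der x : AH := [ffun s => chi s *: x s].

Lemma der_is_linear : linear der.
Proof.
by move=> c x y; apply/ffunP=> s; rewrite !ffunE scalerDr !scalerA mulrC.
Qed.

HB.instance Definition _ := GRing.isLinear.Build k AH AH *:%R der der_is_linear.

Lemma der_mono a s : der (mono a s) = chi s *: mono a s.
Proof. by apply/ffunP=> t; rewrite !ffunE; case: eqP => [->|]; rewrite ?scaler0. Qed.

Lemma iter_der i x : iter i der x = [ffun s => chi s ^+ i *: x s].
Proof.
elim: i => [|i IHi]; first by apply/ffunP=> s; rewrite ffunE scale1r.
by rewrite iterS IHi; apply/ffunP=> s; rewrite !ffunE scalerA -exprS.
Qed.
End Derivation.

Lemma derC chi chi' x : der chi (der chi' x) = der chi' (der chi x).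
Proof. by apply/ffunP=> s; rewrite !ffunE !scalerA mulrC. Qed.

(** Weights add up: [chi t + chi (s - t) = chi s]. *)
Lemma der_derivation (chi : {additive H -> k}) : derivation (der chi).
Proof.
move=> x y; apply/ffunP=> s; rewrite ffunE !gmulE [RHS]ffunE !gmulE scaler_sumr.
rewrite -big_split; apply: eq_bigr => t _ /=; rewrite !ffunE.
by rewrite -scalerAl -scalerAr -scalerDl raddfB [chi t + _]addrC subrK.
Qed.

End GroupRing.

Section Functoriality.
Variables (k : fieldType) (A : comFalgType k).

Definition gmap (H H' : finZmodType) (f : H -> H') (x : gring A H) : gring A H' :=
  [ffun t => \sum_(s | f s == t) x s].

Section Map.
Variables (H H' : finZmodType).

Lemma gmap_is_linear (f : H -> H') : linear (gmap f).
Proof.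
move=> c x y; apply/ffunP=> t; rewrite !ffunE scaler_sumr -big_split.
by apply: eq_bigr => s _; rewrite !ffunE.
Qed.

HB.instance Definition _ (f : H -> H') :=
  GRing.isLinear.Build k (gring A H) (gring A H') *:%R (gmap f) (gmap_is_linear f).

Lemma gmap_mono (f : H -> H') a s : gmap f (mono a s) = mono a (f s).
Proof.
apply/ffunP=> t; rewrite !ffunE big_mkcond (bigD1 s) //= ffunE eqxx eq_sym.
rewrite big1 ?addr0 // => u nus; rewrite ffunE (negPf nus); by case: ifP.
Qed.

Lemma gmap_inj (f : H -> H') x s : injective f -> gmap f x (f s) = x s.
Proof.
move=> injf; rewrite ffunE (bigD1 s) //= big1 ?addr0 // => u /andP[/eqP/injf->].
by rewrite eqxx.
Qed.

Lemma eq_gmap (f g : H -> H') : f =1 g -> gmap f =1 gmap g.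
Proof.
by move=> fg x; apply/ffunP=> t; rewrite !ffunE; apply: eq_bigl => s; rewrite fg.
Qed.

Variable f : {additive H -> H'}.

Lemma gmap_is_monoid_morphism : monoid_morphism (gmap f).
Proof.
split=> [|x y]; first by rewrite [LHS]gmap_mono raddf0.
rewrite (gring_basis x) (gring_basis y) mulr_suml !raddf_sum mulr_suml.
apply: eq_bigr => s _; rewrite !mulr_sumr raddf_sum; apply: eq_bigr => t _ /=.
by rewrite monoM !gmap_mono monoM raddfD.
Qed.

HB.instance Definition _ := GRing.isMonoidMorphism.Build (gring A H) (gring A H')
  (gmap f) gmap_is_monoid_morphism.

End Map.

Lemma gmap_comp (H H' H'' : finZmodType) (f : H -> H') (g : H' -> H'') x :
  gmap g (gmap f x) = gmap (g \o f) x.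
Proof.
rewrite (gring_basis x) !raddf_sum; apply: eq_bigr => s _ /=.
by rewrite !gmap_mono.
Qed.

Lemma gmap_id (H : finZmodType) (f : H -> H) x : f =1 id -> gmap f x = x.
Proof. by move=> fid; apply/ffunP=> s; rewrite (eq_gmap fid) (@gmap_inj _ _ id). Qed.

Lemma der_gmap (H H' : finZmodType) (f : H -> H') (chi : H' -> k) x :
  der chi (gmap f x) = gmap f (der (chi \o f) x).
Proof.
rewrite (gring_basis x) !raddf_sum; apply: eq_bigr => s _ /=.
by rewrite gmap_mono !der_mono linearZ /= gmap_mono.
Qed.

End Functoriality.

(** Frobenius is additive and sends group elements to the neutral one, so [x ^+ p] depends only on
    the augmentation of [x]. In particular augmentation 1 makes [x] a unit with inverse
    [x ^+ p.-1]. *)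
Lemma expr_gring (k : fieldType) (p : nat) (A : comFalgType k) (H : finZmodType)
    (x : gring A H) : p \in [pchar k] -> (forall s : H, s *+ p = 0) ->
  x ^+ p = gmap (\0 : H -> H) x ^+ p.
Proof.
move=> charp Hp; have chR : p \in [pchar gring A H] by rewrite pchar_lalg.
rewrite (gring_basis x) raddf_sum -!(pFrobenius_autE chR) !raddf_sum /=.
apply: eq_bigr => s _.
by rewrite gmap_mono !pFrobenius_autE !monoX /= Hp mul0rn.
Qed.

Record grading (k : fieldType) (A : comFalgType k) (G : finZmodType) := Grading {
  gpart :> G -> A -> A;
  gpart_linear : forall g, linear (gpart g);
  gpart_one : forall g, gpart g 1 = if g == 0 then 1 else 0;
  gpartM : forall g a b, gpart g (a * b) = \sum_h gpart h a * gpart (g - h) b;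
  gpart_idem : forall g h a, gpart g (gpart h a) = if g == h then gpart h a else 0
}.

Section Coaction.
Variables (k : fieldType) (A : comFalgType k) (G : finZmodType) (pi : grading A G).

HB.instance Definition _ g :=
  GRing.isLinear.Build k A A *:%R (pi g) (gpart_linear pi g).

(** The face d^0: a coefficient is split into its homogeneous parts, whose degree becomes the new
    first variable. *)
Definition coact (H : finZmodType) (x : gring A H) : gring A (G * H)%type :=
  [ffun u => pi u.1 (x u.2)].

Section Coact.
Variable H : finZmodType.

Lemma coact_is_linear : linear (@coact H).
Proof. by move=> c x y; apply/ffunP=> u; rewrite !ffunE linearP. Qed.

HB.instance Definition _ :=
  GRing.isLinear.Build k (gring A H) (gring A (G * H)%type) *:%R (@coact H)
    coact_is_linear.

Lemma coact_is_monoid_morphism : monoid_morphism (@coact H).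
Proof.
split=> [|x y]; apply/ffunP=> -[g s]; rewrite ffunE /=.
  rewrite !goneE -[0 in RHS]/(0, 0) xpair_eqE.
  by case: (s == 0); rewrite ?andbF ?raddf0 // gpart_one andbT.
rewrite !gmulE raddf_sum.
transitivity (\sum_h \sum_t coact x (h, t) * coact y ((g, s) - (h, t))).
  rewrite exchange_big; apply: eq_bigr => t _ /=.
  by rewrite gpartM; apply: eq_bigr => h _; rewrite !ffunE.
by rewrite pair_bigA; apply: eq_bigr => -[].
Qed.

HB.instance Definition _ := GRing.isMonoidMorphism.Build (gring A H)
  (gring A (G * H)%type) (@coact H) coact_is_monoid_morphism.

Lemma der_coact (chi : H -> k) x : der (chi \o snd) (coact x) = coact (der chi x).
Proof. by apply/ffunP=> u; rewrite !ffunE linearZ. Qed.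

(** Coassociativity: a part of degree [h] has no part of another degree. *)
Lemma coact_coact (x : gring A H) :
  coact (coact x) = gmap (pairf fst idfun) (coact x).
Proof.
apply/ffunP=> -[g [h s]]; rewrite ffunE /= ffunE /= gpart_idem.
have [->|ngh] := eqVneq g h.
  rewrite -[(h, (h, s))]/(pairf fst idfun (h, s)) gmap_inj ?ffunE // => u v [_].
  by [].
rewrite ffunE big_pred0 // => -[a b]; rewrite /pairf /= xpair_eqE.
by case: eqP => //= -> ; rewrite xpair_eqE (negPf ngh).
Qed.

Lemma coact_mono a (s : H) : coact (mono a s) = \sum_g mono (pi g a) (g, s).
Proof.
apply/ffunP=> -[h t]; rewrite gsumE (bigD1 h) //= big1 => [|g ngh]; last first.
  by rewrite ffunE xpair_eqE eq_sym (negPf ngh).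
by rewrite !ffunE xpair_eqE eqxx addr0 /=; case: eqP; rewrite ?raddf0.
Qed.
End Coact.

Lemma coact_gmap (H H' : finZmodType) (f : H -> H') (x : gring A H) :
  coact (gmap f x) = gmap (pairf fst (f \o snd)) (coact x).
Proof.
rewrite (gring_basis x) !raddf_sum; apply: eq_bigr => s _ /=.
rewrite gmap_mono !coact_mono raddf_sum; apply: eq_bigr => g _.
by rewrite /= gmap_mono.
Qed.
End Coaction.

(** * Degree 2 cohomology in terms of group rings *)

Lemma inv_cancel (R : comNzRingType) (s s' x y : R) :
  s * s' = 1 -> x * s = y * s -> x = y.
Proof. by move=> ss' /(congr1 ( *%R^~ s')); rewrite -!mulrA ss' !mulr1. Qed.

(** [D (D' s)] and [D' (D s)] share the term [l * l' * s]. *)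
Lemma dlog_flat (R : comNzRingType) (D D' : {additive R -> R}) (s s' l l' : R) :
    derivation D -> derivation D' -> (forall x, D (D' x) = D' (D x)) ->
    s * s' = 1 -> D s = l * s -> D' s = l' * s ->
  D l' = D' l.
Proof.
move=> derD derD' DD' ss' Ds Ds'; apply: (inv_cancel ss').
have := DD' s; rewrite Ds Ds' derD derD' Ds Ds' => /eqP.
by rewrite !mulrA [l * l']mulrC => /eqP /addIr.
Qed.

Section Cohomology.
Variables (k : closedFieldType) (p : nat).
Hypothesis charp : p \in [pchar k].
Variables (A : comFalgType k) (G : finZmodType) (pi : grading A G).
Variables (n : nat) (chi : 'I_n -> {additive G -> k}) (h : 'I_n -> G).
Hypothesis chi_pow : forall i s, chi i s ^+ p = chi i s.
Hypothesis chi_h : forall i j, chi i (h j) = - (i == j)%:R.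
Hypothesis chi_sep : forall s, (forall i, chi i s = 0) -> s = 0.
Hypothesis mulGp : forall s : G, s *+ p = 0.

Local Notation R1 := (gring A G).
Local Notation R2 := (gring A (G * G)%type).
Local Notation R3 := (gring A (G * (G * G))%type).

(* [f1], [f2], [f3] are the faces of degree 2 and [diag], [inl] those of degree 1;
   [e] and [pr] set the last variable to 1. *)
Let f1 : {additive (G * G)%type -> (G * (G * G))%type} := pairf fst idfun.
Let f2 : {additive (G * G)%type -> (G * (G * G))%type} := pairf fst (pairf snd snd).
Let f3 : {additive (G * G)%type -> (G * (G * G))%type} := pairf fst (pairf snd \0).
Let diag : {additive G -> (G * G)%type} := pairf idfun idfun.
Let inl : {additive G -> (G * G)%type} := pairf idfun \0.
Let e : {additive (G * (G * G))%type -> (G * G)%type} := pairf fst (fst \o snd).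
Let pr : {additive (G * G)%type -> G} := fst.

(** The inverse faces of the differential are moved to the right side. *)
Definition cocycle2 (x : R2) : Prop :=
  coact pi x * gmap f2 x = gmap f1 x * gmap f3 x.

Let D i : {linear R1 -> R1} := der (chi i).
Let E i : {additive R2 -> R2} := der (chi i \o snd).

Lemma iter_der_chi (H : finZmodType) (psi : H -> k) (x : gring A H) :
  (forall s, psi s ^+ p = psi s) -> iter p (der psi) x = der psi x.
Proof. by move=> psip; rewrite iter_der; apply/ffunP=> s; rewrite !ffunE psip. Qed.

(** Differentiate the cocycle identity in the last variable. The face [f3] does not involve it, so
    dividing by the unit [coact pi x * gmap f2 x] leaves [coact pi l + gmap f2 l = gmap f1 l]. Under
    [e], the face [f2] becomes the identity and [f1] becomes [diag] after [fst]. *)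
Lemma dlog_cocycle i (x x' : R2) l : x * x' = 1 -> cocycle2 x ->
    der (chi i \o snd) x = l * x ->
  l = gmap diag (gmap fst l) - coact pi (gmap fst l).
Proof.
move=> xx' cx lx.
pose X : {linear R3 -> R3} := der ((chi i \o snd) \o snd).
have X0 : X (coact pi x) = coact pi l * coact pi x.
  by rewrite /X /= der_coact lx rmorphM.
have X1 : X (gmap f1 x) = gmap f1 l * gmap f1 x by rewrite /X /= der_gmap lx rmorphM.
have X2 : X (gmap f2 x) = gmap f2 l * gmap f2 x by rewrite /X /= der_gmap lx rmorphM.
have X3 : X (gmap f3 x) = 0.
  rewrite /X /= der_gmap (_ : der _ x = 0) ?raddf0 //; apply/ffunP=> s.
  by rewrite !ffunE /= raddf0 scale0r.
have derX : derivation X by apply: der_derivation.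
have PP' : (coact pi x * gmap f2 x) * (coact pi x' * gmap f2 x') = 1.
  by rewrite mulrACA -!rmorphM xx' !rmorph1 mulr1.
have := congr1 X cx; rewrite !derX X0 X1 X2 X3 mulr0 addr0 => eX.
have /(inv_cancel PP')/(congr1 (gmap e)) : (coact pi l + gmap f2 l) *
    (coact pi x * gmap f2 x) = gmap f1 l * (coact pi x * gmap f2 x).
  by rewrite [in RHS]cx [RHS]mulrA -eX; ring.
rewrite raddfD /= !gmap_comp => el.
rewrite [gmap (e \o f2) l]gmap_id in el; last by case.
apply/eqP; rewrite eq_sym subr_eq eq_sym addrC coact_gmap el.
by apply/eqP/eq_gmap; case.
Qed.

(* [gmap \0 a = a] says that [a] is constant, and then [coact pi a] is its
   coboundary. *)
Lemma cocycle2_der0 (x x' : R2) : x * x' = 1 -> cocycle2 x ->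
    (forall i, der (chi i \o snd) x = 0) ->
  exists a a' : R1, [/\ a * a' = 1, gmap (\0 : G -> G) a = a & x = coact pi a].
Proof.
move=> xx' cx x0.
pose s := gmap pr x.
(* The characters separate points, so [x] is supported on pairs [(a, 0)]. *)
have xE : x = gmap inl s.
  rewrite gmap_comp (gring_basis x) raddf_sum; apply: eq_bigr => -[a b] _.
  rewrite /= gmap_mono; have [-> // | nb0] := eqVneq b 0.
  suff -> : x (a, b) = 0.
    by apply/ffunP=> t; rewrite !ffunE; do 2 case: ifP.
  have /existsP[i nchi] : [exists i, chi i b != 0].
    apply: contraR nb0 => /existsPn chi0; apply/eqP/chi_sep => i.
    by apply/eqP; rewrite -[_ == _]negbK chi0.
  have /ffunP/(_ (a, b)) := x0 i; rewrite !ffunE /= => /eqP.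
  by rewrite scaler_eq0 (negPf nchi) => /eqP.
(* As [f2] and [f3] agree on [x], the cocycle identity reduces to [coact pi x = gmap f1 x]; then [e]
   drops the last variable. *)
have s_diag : coact pi s = gmap diag s.
  have : coact pi (gmap inl s) = gmap f1 (gmap inl s).
    have f2x : gmap f2 x = gmap f3 x.
      by rewrite xE !gmap_comp; apply: eq_gmap.
    have f3x : gmap f3 x * gmap f3 x' = 1 by rewrite -rmorphM xx' rmorph1.
    by rewrite -xE; apply: (inv_cancel f3x); rewrite -cx f2x.
  move/(congr1 (gmap e)); rewrite coact_gmap !gmap_comp.
  rewrite gmap_id; last by case.
  by move=> ->; apply: eq_gmap.
pose z : {additive G -> G} := \0.
exists (gmap z s), (gmap z (gmap pr x')); split.
- by rewrite -!rmorphM xx' !rmorph1.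
- by rewrite gmap_comp; apply: eq_gmap.
(* The map [(a, b) |-> (a, 0)] turns the right side of [s_diag] into [gmap inl s = x] and the left
   side into [coact pi (gmap z s)]. *)
rewrite coact_gmap s_diag gmap_comp xE.
by apply: eq_gmap.
Qed.

(** By the simplicial identities the faces of faces match up, apart from two pairs of mutually
    inverse factors, [c2] and [c3]. *)
Lemma coboundary_cocycle2 (v v' : R1) : v * v' = 1 ->
  cocycle2 (coact pi v * gmap diag v' * gmap inl v).
Proof.
move=> vv'.
have d20 (y : R1) : coact pi (gmap diag y) = gmap f2 (coact pi y).
  by rewrite coact_gmap; apply: eq_gmap.
have d30 (y : R1) : coact pi (gmap inl y) = gmap f3 (coact pi y).
  by rewrite coact_gmap; apply: eq_gmap.
have d21 (y : R1) : gmap f1 (gmap diag y) = gmap f2 (gmap diag y).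
  by rewrite !gmap_comp; apply: eq_gmap.
have d31 (y : R1) : gmap f1 (gmap inl y) = gmap f3 (gmap diag y).
  by rewrite !gmap_comp; apply: eq_gmap.
have d32 (y : R1) : gmap f2 (gmap inl y) = gmap f3 (gmap inl y).
  by rewrite !gmap_comp; apply: eq_gmap.
have c2 : gmap f2 (coact pi v) * gmap f2 (coact pi v') = 1.
  by rewrite -!rmorphM vv' !rmorph1.
have c3 : gmap f3 (gmap diag v) * gmap f3 (gmap diag v') = 1.
  by rewrite -!rmorphM vv' !rmorph1.
rewrite /cocycle2 !rmorphM /= d20 d30 d21 d31 d32 coact_coact.
set x1 := gmap f1 _; set x2 := gmap f3 (coact pi v).
set x3 := gmap f2 (gmap diag v'); set x4 := gmap f3 (gmap inl v).
transitivity (x1 * x2 * x3 * x4 * (gmap f2 (coact pi v) * gmap f2 (coact pi v'))).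
  by ring.
by rewrite c2 -c3; ring.
Qed.

Lemma cocycle2M (x y : R2) : cocycle2 x -> cocycle2 y -> cocycle2 (x * y).
Proof. by rewrite /cocycle2 !rmorphM /= => cx cy; rewrite mulrACA cx cy mulrACA. Qed.

Theorem gring_H2_trivial (x x' : R2) : x * x' = 1 -> cocycle2 x ->
  exists u u' : R1, u * u' = 1 /\ x = coact pi u * gmap diag u' * gmap inl u.
Proof.
move=> xx' cx.
pose l i : R2 := E i x * x'.
have lx i : E i x = l i * x by rewrite /l -mulrA [x' * x]mulrC xx' mulr1.
have derD i : derivation (D i) by apply: der_derivation.
have derE i : derivation (E i) by apply: der_derivation.
have commD i j y : D i (D j y) = D j (D i y) by apply: derC.
have iterD i y : iter p (D i) y = D i y by apply: iter_der_chi.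
have d0D i y : coact pi (D i y) = E i (coact pi y) by rewrite /E /= der_coact.
have d1D i y : gmap diag (D i y) = E i (gmap diag y) by rewrite /E /= der_gmap.
have flat_l i j : E i (l j) = E j (l i).
  by apply: (dlog_flat (derE i) (derE j) _ xx' (lx i) (lx j)) => y; apply: derC.
have charR2 : p \in [pchar R2] by rewrite pchar_lalg.
have pot_l i : potential p (E i) (l i) = l i.
  apply: (potential_dlog (derE i) xx' (lx i)).
  by apply: iter_der_chi => s; apply: chi_pow.
have [|w [lw flat_w pot_w]] :=
  gauge charp derD commD iterD derE d0D d1D flat_l pot_l.
  by exists (fun i => gmap fst (l i)) => i; apply: (dlog_cocycle xx' cx (lx i)).
pose z : {additive G -> G} := \0.
(* The shifting elements are the group elements [h i], and [eps] is the augmentation. *)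
have [||v [v1 Dv]] := integrate charp derD commD iterD
  (eps := gmap z) (h := fun i => mono 1 (h i)) _ _ flat_w pot_w.
- move=> i j; rewrite /D /= der_mono chi_h scaleNr scaler_nat; congr (- _).
- by move=> i; rewrite /= gmap_mono.
have p_gt0 := prime_gt0 (pcharf_prime charp).
pose v' := v ^+ p.-1.
have vv' : v * v' = 1.
  by rewrite -exprS prednK // (expr_gring v charp mulGp) [gmap _ v]v1 expr1n.
(* The quotient of [x] by the coboundary of [v']. *)
pose y := x * (coact pi v * gmap diag v' * gmap inl v).
pose y' := x' * (coact pi v' * gmap diag v * gmap inl v').
have inlvv' : gmap inl v * gmap inl v' = 1 by rewrite -rmorphM vv' rmorph1.
have diagvv' : gmap diag v * gmap diag v' = 1 by rewrite -rmorphM vv' rmorph1.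
have coactvv' : coact pi v * coact pi v' = 1 by rewrite -rmorphM vv' rmorph1.
have yy' : y * y' = 1.
  transitivity (x * x' * (gmap inl v * gmap inl v') *
    (gmap diag v * gmap diag v') * (coact pi v * coact pi v')).
    by rewrite /y /y'; ring.
  by rewrite xx' inlvv' diagvv' coactvv' !mulr1.
have Dv' i : D i v' = - w i * v'.
  apply: (inv_cancel vv').
  have /esym/eqP := derD i v v'; rewrite vv' (derivation1 (derD i)) Dv.
  by rewrite addrC addr_eq0 mulrC => /eqP ->; ring.
have Einl i : E i (gmap inl v) = 0.
  rewrite /E /= der_gmap (_ : der _ v = 0) ?raddf0 //.
  by apply/ffunP=> s; rewrite !ffunE /= raddf0 scale0r.
(* The logarithmic derivative of [y] is [l i + coact pi (w i) - gmap diag (w i)]. *)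
have Ey i : E i y = 0.
  rewrite /y !derE lx Einl -d0D -d1D Dv Dv' !rmorphM rmorphN /= lw.
  ring.
have [a [a' [aa' a0 ya]]] :=
  cocycle2_der0 yy' (cocycle2M cx (coboundary_cocycle2 vv')) Ey.
(* [x] is [y] times the coboundary of [v'], and [y] is the coboundary of [a], whose faces under
   [diag] and [inl] coincide. *)
exists (a * v'), (a' * v); split.
  by rewrite mulrACA aa' [v' * v]mulrC vv' mulr1.
have diag_a : gmap inl a = gmap diag a.
  by rewrite -a0 !gmap_comp; apply: eq_gmap.
have diagaa' : gmap diag a * gmap diag a' = 1 by rewrite -rmorphM aa' rmorph1.
rewrite !rmorphM /= diag_a -ya /y.
transitivity (x * (gmap inl v * gmap inl v') *
    (gmap diag v * gmap diag v') * (coact pi v * coact pi v') *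
    (gmap diag a * gmap diag a')).
  by rewrite inlvv' diagvv' coactvv' diagaa' !mulr1.
by ring.
Qed.
End Cohomology.

(** * Characters of C_p^n *)

Section CyclicPower.
Variables p n : nat.
Local Notation G := (cyclic_power p n).

(* [cyclic_power p n] written additively. *)
Definition cpow : Type := G.
HB.instance Definition _ := Finite.on cpow.

Lemma cyclic_power_mulC (x y : G) : (x * y = y * x)%g.
Proof. by apply/ffunP=> i; rewrite !ffunE; apply: addrC. Qed.

HB.instance Definition _ :=
  GRing.isZmodule.Build cpow (@mulgA G) cyclic_power_mulC (@mul1g G) (@mulVg G).

Lemma cpowDE (x y : cpow) i : (x + y) i = x i + y i.
Proof. exact: ffunE. Qed.

Variable k : fieldType.
Hypothesis charp : p \in [pchar k].
Hypothesis p_gt1 : (1 < p)%N.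

(** The i-th coordinate, read in the prime field of [k]. *)
Definition cpow_char (i : 'I_n) (x : cpow) : k := (x i : nat)%:R.

Lemma cpow_charD i x y : cpow_char i (x + y) = cpow_char i x + cpow_char i y.
Proof.
have natZp m : (m %% (Zp_trunc p).+2)%:R = m%:R :> k.
  by rewrite Zp_cast // GRing.natr_mod_pchar.
by rewrite /cpow_char cpowDE -natrD natZp.
Qed.

Lemma cpow_char_is_additive i : zmod_morphism (cpow_char i).
Proof. by move=> x y; rewrite -{2}[x](subrK y) [cpow_char i (_ + y)]cpow_charD addrK. Qed.

Lemma cpow_charX i x : cpow_char i x ^+ p = cpow_char i x.
Proof. exact: expr_nat_pchar. Qed.

Lemma cpow_char_sep x : (forall i, cpow_char i x = 0) -> x = 0.
Proof.
move=> x0; apply/ffunP=> i; rewrite [RHS]ffunE; apply: val_inj => /=.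
apply/eqP; rewrite -(natr_pchar_eq0 charp); first exact/eqP/x0.
by rewrite -[X in (_ < X)%N](Zp_cast p_gt1).
Qed.

Lemma cpowMn (x : cpow) : x *+ p = 0.
Proof.
apply: cpow_char_sep => i.
have {1}-> : p = p.-1.+1 by rewrite prednK // ltnW.
suff XE m : cpow_char i (x *+ m) = cpow_char i x *+ m.
  by rewrite XE prednK ?(ltnW p_gt1) // -mulr_natr (pcharf0 charp) mulr0.
elim: m => [|m IHm]; first by rewrite !mulr0n /cpow_char [_ i]ffunE.
by rewrite !mulrS cpow_charD IHm.
Qed.

(** The sign makes multiplication by this element lower eigenvalues. *)
Definition cpow_gen (j : 'I_n) : cpow := - ([ffun i => (i == j)%:R] : cpow).

Lemma cpow_char_gen i j : cpow_char i (cpow_gen j) = - (i == j)%:R.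
Proof.
rewrite /cpow_gen -sub0r cpow_char_is_additive /cpow_char ffunE sub0r ffunE.
by case: eqP.
Qed.
End CyclicPower.

(** * Sweedler cochains as elements of group rings *)

Section Dictionary.
Variables (k : fieldType) (p n : nat).
Local Notation G := (cpow p n).
Local Notation kG := (group_algebra k (cyclic_power p n)).
Local Notation K := (dual kG).

Definition eval_at (x : K) (g : G) : k := dapp x (gdelta k g).

(** [K] is the algebra of functions on [G], and these are its primitive idempotents. *)
Definition gidem (g : G) : K := mkdual (fun x : kG => x g).

Lemma eval_linear g : linear (fun x : K => eval_at x g : k^o).
Proof. exact: dapp_linearl. Qed.

Lemma eval_idem g h : eval_at (gidem g) h = (g == h)%:R.
Proof. by rewrite /eval_at mkdualE => [|a x y]; rewrite !ffunE. Qed.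

Lemma eval_atM x y g : eval_at (x * y) g = eval_at x g * eval_at y g.
Proof.
rewrite /eval_at dappM (galg_comul_bilE _ (dapp_bil x y)).
by rewrite (sum_gdelta (fun h => dapp x (gdelta k h) * dapp y (gdelta k h) : k^o)).
Qed.

Lemma counit_eval x : counit x = eval_at x 0.
Proof. by []. Qed.

Lemma comul_eval x g h :
  \sum_(c <- comul x) eval_at c.1 g * eval_at c.2 h = eval_at x (g + h).
Proof. by rewrite [LHS]dual_comul_app gdeltaM. Qed.

Lemma idem_basis x : x = \sum_g eval_at x g *: gidem g.
Proof.
apply: dualP => y; rewrite dapp_sum [in LHS](galg_basis y) dapp_comb.
apply: eq_bigr => g _; rewrite dappZ mulrC; congr (_ * _).
by rewrite mkdualE // => a u v; rewrite !ffunE.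
Qed.

Variable A : comFalgType k.

Section Grading.
Variable M : module_algebra K A.

Lemma act_idem x a : M x a = \sum_g eval_at x g *: M (gidem g) a.
Proof.
rewrite {1}(idem_basis x) (bil_suml (act_bilinear M)).
by apply: eq_bigr => g _; rewrite (bilZl (act_bilinear M)).
Qed.

Lemma act_idem_linear g : linear (M (gidem g)).
Proof. exact: (act_bilinear M).2. Qed.

Lemma act_idem1 g : M (gidem g) 1 = if g == 0 then 1 else 0.
Proof.
rewrite (act_one M) counit_eval eval_idem.
by case: eqP; rewrite ?scale1r ?scale0r.
Qed.

(** The comultiplication sends [gidem g] to the sum of the tensors of [gidem h] and
    [gidem (g - h)]. *)
Lemma act_idemM g a b :
  M (gidem g) (a * b) = \sum_h M (gidem h) a * M (gidem (g - h)) b.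
Proof.
rewrite (act_mul M).
transitivity (\sum_h \sum_t eval_at (gidem g) (h + t) *: (M (gidem h) a * M (gidem t) b)).
  under eq_bigr => c _.
    rewrite (act_idem c.1) (act_idem c.2) mulr_suml.
    under eq_bigr => h _ do rewrite mulr_sumr.
    over.
  rewrite exchange_big; apply: eq_bigr => h _ /=.
  rewrite exchange_big; apply: eq_bigr => t _ /=.
  rewrite -comul_eval scaler_suml; apply: eq_bigr => c _.
  by rewrite -scalerAl -scalerAr scalerA.
apply: eq_bigr => h _; rewrite (bigD1 (g - h)) //= eval_idem [h + _]addrC subrK eqxx scale1r.
rewrite big1 ?addr0 // => t nt.
by rewrite eval_idem [h + t]addrC -subr_eq eq_sym (negPf nt) scale0r.
Qed.

Lemma act_idem_idem g h a :
  M (gidem g) (M (gidem h) a) = if g == h then M (gidem h) a else 0.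
Proof.
rewrite -(Defs.actM M) act_idem (bigD1 h) //= eval_atM !eval_idem eqxx mulr1 big1 ?addr0 => [|t nth].
  by case: eqP; rewrite ?scale1r ?scale0r.
by rewrite eval_atM !eval_idem [h == t]eq_sym (negPf nth) mulr0 scale0r.
Qed.

Definition act_grading : grading A G :=
  Grading act_idem_linear act_idem1 act_idemM act_idem_idem.
End Grading.

Definition eval_tuple m (h : m.-tuple K) (s : m.-tuple G) : k :=
  \prod_(i < m) eval_at (tnth h i) (tnth s i).

Lemma comul_eval_tuple m (h : m.-tuple K) (s t u : m.-tuple G) :
    (forall i, tnth u i = tnth s i + tnth t i) ->
  \sum_(c <- comul_tuple h) eval_tuple c.1 s * eval_tuple c.2 t = eval_tuple h u.
Proof.
rewrite /eval_tuple; elim: m h s t u => [|q IHq] h s t u uE.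
  by rewrite big_seq1 !big_ord0 mulr1.
case/tupleP: h => x h; case/tupleP: s uE => a s; case/tupleP: t => b t.
case/tupleP: u => c u uE; have uE0 := uE ord0; rewrite !tnth0 in uE0.
have uES i : tnth u i = tnth s i + tnth t i.
  by have := uE (lift ord0 i); rewrite !tnthS.
rewrite [comul_tuple _]/= big_allpairs_dep /= theadE.
rewrite big_ord_recl !tnth0 uE0 -comul_eval mulr_suml; apply: eq_bigr => y _.
under [X in _ = _ * X]eq_bigr => i _ do rewrite !tnthS.
rewrite -(IHq _ s t u uES) mulr_sumr.
rewrite (_ : behead_tuple [tuple of x :: h] = h); last exact: val_inj.
apply: eq_bigr => z _; rewrite !big_ord_recl !tnth0 /=.
under eq_bigr => i _ do rewrite !tnthS.
under [X in _ * (_ * X) = _]eq_bigr => i _ do rewrite !tnthS.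
by rewrite mulrACA.
Qed.

Section Cochains.
Variables (m : nat) (H : finZmodType) (co : H -> m.-tuple G).
Hypothesis coD : forall s t i, tnth (co (s + t)) i = tnth (co s) i + tnth (co t) i.

(** The tensor power of [K] is dual to the group algebra of G^m, so linear maps from it to [A] are
    elements of A[G^m]. The map [co] turns the nested pairs of [H] into tuples. *)
Definition cochain (x : gring A H) (h : m.-tuple K) : A :=
  \sum_s eval_tuple h (co s) *: x s.

Lemma co0 i : tnth (co 0) i = 0.
Proof. by apply: (addrI (tnth (co 0) i)); rewrite -coD !addr0. Qed.

(** The comultiplication of the tensor power is dual to addition in G^m. *)
Lemma cochainM x y : conv (cochain x) (cochain y) =1 cochain (x * y).
Proof.
move=> h; rewrite /conv /cochain.
transitivity (\sum_s \sum_t eval_tuple h (co (s + t)) *: (x s * y t)).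
  under eq_bigr => c _ do rewrite mulr_suml.
  rewrite exchange_big; apply: eq_bigr => s _ /=.
  under eq_bigr => c _ do rewrite mulr_sumr.
  rewrite exchange_big; apply: eq_bigr => t _ /=.
  rewrite -(comul_eval_tuple h (coD s t)) scaler_suml; apply: eq_bigr => c _.
  by rewrite -scalerAl -scalerAr scalerA.
under [RHS]eq_bigr => s _ do rewrite gmulE scaler_sumr.
rewrite [RHS]exchange_big; apply: eq_bigr => s _ /=.
rewrite [RHS](reindex_inj (addrI s)); apply: eq_bigr => t _ /=.
by rewrite addrAC subrr add0r.
Qed.

Lemma cochain1 : @conv1 k K A m =1 cochain 1.
Proof.
move=> h; rewrite /conv1 /cochain (bigD1 0) //= [X in _ = _ + X]big1 => [|s ns0]; last first.
  by rewrite goneE (negPf ns0) scaler0.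
rewrite goneE eqxx addr0 /eval_tuple big_tuple; congr (_ *: _).
by apply: eq_bigr => i _; rewrite co0.
Qed.

Hypothesis co_inj : injective co.

Lemma cochain_idem x s : cochain x [tuple gidem (tnth (co s) i) | i < m] = x s.
Proof.
rewrite /cochain (bigD1 s) //= big1 => [|t nts].
  rewrite addr0 /eval_tuple big1 ?scale1r // => i _.
  by rewrite tnth_mktuple eval_idem eqxx.
have /existsP[i nei] : [exists i, tnth (co s) i != tnth (co t) i].
  apply: contraR nts => /existsPn e; apply/eqP/co_inj/esym/eq_from_tnth => i.
  by apply/eqP; rewrite -[_ == _]negbK e.
by rewrite /eval_tuple (bigD1 i) //= tnth_mktuple eval_idem (negPf nei) mul0r scale0r.
Qed.

Lemma cochain_inj x y : cochain x =1 cochain y -> x = y.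
Proof. by move=> xy; apply/ffunP=> s; rewrite -!cochain_idem xy. Qed.

End Cochains.
End Dictionary.

(** * Faces and differentials in degrees 1 and 2 *)

Lemma eq_conv (k : fieldType) (K : hopfAlgType k) (A : comAlgType k) m
    (f f' g g' : m.-tuple K -> A) :
  f =1 f' -> g =1 g' -> conv f g =1 conv f' g'.
Proof. by move=> ff' gg' h; apply: eq_bigr => c _; rewrite ff' gg'. Qed.

Lemma tuple1E (T : Type) (t : 1.-tuple T) : t = [tuple tnth t 0].
Proof. by apply: eq_from_tnth => i; rewrite ord1. Qed.

Lemma tuple2E (T : Type) (t : 2.-tuple T) : t = [tuple tnth t 0; tnth t 1].
Proof.
by apply: eq_from_tnth => -[[|[|]]] //= i; rewrite [RHS](tnth_nth (tnth t 0)) /=;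
   congr (tnth t _); apply: val_inj.
Qed.

Lemma tuple3P (T : Type) (t : 3.-tuple T) : exists x y z, t = [tuple x; y; z].
Proof.
exists (tnth t 0), (tnth t 1), (tnth t 2%:R).
by apply: eq_from_tnth => -[[|[|[|]]]] //= i; rewrite [RHS](tnth_nth (tnth t 0)) /=;
   congr (tnth t _); apply: val_inj.
Qed.

Section Faces.
Variables (k : fieldType) (K : hopfAlgType k) (A : comAlgType k).
Variable M : module_algebra K A.

Section Face1.
Variable f : 1.-tuple K -> A.

Lemma face1_0 x y : face M 0 f [tuple x; y] = M x (f [tuple y]).
Proof. by rewrite /face /= [mktuple _]tuple1E tnth_mktuple. Qed.

Lemma face1_1 x y : face M 1 f [tuple x; y] = f [tuple x * y].
Proof. by rewrite /face /= [mktuple _]tuple1E tnth_mktuple. Qed.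

Lemma face1_2 x y : face M 2 f [tuple x; y] = counit y *: f [tuple x].
Proof. by rewrite /face /= [mktuple _]tuple1E tnth_mktuple. Qed.
End Face1.

Section Face2.
Variable f : 2.-tuple K -> A.

Lemma face2_0 x y z : face M 0 f [tuple x; y; z] = M x (f [tuple y; z]).
Proof. by rewrite /face /= [mktuple _]tuple2E !tnth_mktuple. Qed.

Lemma face2_1 x y z : face M 1 f [tuple x; y; z] = f [tuple x * y; z].
Proof. by rewrite /face /= [mktuple _]tuple2E !tnth_mktuple. Qed.

Lemma face2_2 x y z : face M 2 f [tuple x; y; z] = f [tuple x; y * z].
Proof. by rewrite /face /= [mktuple _]tuple2E !tnth_mktuple. Qed.

Lemma face2_3 x y z : face M 3 f [tuple x; y; z] = counit z *: f [tuple x; y].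
Proof. by rewrite /face /= [mktuple _]tuple2E !tnth_mktuple. Qed.
End Face2.

Lemma differential1E (g : Reg K A 1) : differential M g =1
  conv (face M 0 g) (conv (face M 1 (reg_inv g)) (conv (face M 2 g) (@conv1 k K A 2))).
Proof. by move=> h; rewrite /differential !big_ord_recl big_ord0. Qed.

Lemma differential2E (g : Reg K A 2) : differential M g =1
  conv (face M 0 g) (conv (face M 1 (reg_inv g)) (conv (face M 2 g)
    (conv (face M 3 (reg_inv g)) (@conv1 k K A 3)))).
Proof. by move=> h; rewrite /differential !big_ord_recl big_ord0. Qed.

End Faces.

Lemma cochain_gmap (k : fieldType) (p n : nat) (A : comFalgType k)
    (H H' : finZmodType) (m : nat) (co : H' -> m.-tuple (cpow p n)) (f : H -> H')
    (x : gring A H) h :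
  cochain co (gmap f x) h = \sum_s eval_tuple h (co (f s)) *: x s.
Proof.
rewrite /cochain; under eq_bigr => t _ do rewrite ffunE scaler_sumr.
rewrite (exchange_big_dep predT) //=; apply: eq_bigr => s _.
by rewrite (big_pred1 (f s)) // => t; rewrite eq_sym.
Qed.

Section LowDegree.
Variables (k : fieldType) (p n : nat) (A : comFalgType k).
Local Notation G := (cpow p n).
Local Notation K := (dual (group_algebra k (cyclic_power p n))).
Variable M : module_algebra K A.
Let pi := act_grading M.

Definition co1 (a : G) : 1.-tuple G := [tuple a].
Definition co2 (u : G * G) : 2.-tuple G := [tuple u.1; u.2].
Definition co3 (u : G * (G * G)) : 3.-tuple G := [tuple u.1; u.2.1; u.2.2].

Lemma co1D s t i : tnth (co1 (s + t)) i = tnth (co1 s) i + tnth (co1 t) i.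
Proof. by rewrite ord1. Qed.

Lemma co2D s t i : tnth (co2 (s + t)) i = tnth (co2 s) i + tnth (co2 t) i.
Proof. by rewrite !(tnth_nth 0); case: i => -[|[|]]. Qed.

Lemma co3D s t i : tnth (co3 (s + t)) i = tnth (co3 s) i + tnth (co3 t) i.
Proof. by rewrite !(tnth_nth 0); case: i => -[|[|[|]]]. Qed.

Lemma co2_inj : injective co2.
Proof. by move=> [a b] [a' b'] [-> ->]. Qed.

Lemma co3_inj : injective co3.
Proof. by move=> [a [b c]] [a' [b' c']] [-> -> ->]. Qed.

Lemma eval_tuple1E (x : K) a : eval_tuple [tuple x] (co1 a) = eval_at x a.
Proof. by rewrite /eval_tuple big_ord1. Qed.

Lemma eval_tuple2E (x y : K) u : eval_tuple [tuple x; y] (co2 u) = eval_at x u.1 * eval_at y u.2.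
Proof. by rewrite /eval_tuple !big_ord_recl big_ord0 mulr1 !(tnth_nth 0). Qed.

Lemma eval_tuple3E (x y z : K) u :
  eval_tuple [tuple x; y; z] (co3 u) = eval_at x u.1 * (eval_at y u.2.1 * eval_at z u.2.2).
Proof. by rewrite /eval_tuple !big_ord_recl big_ord0 mulr1 !(tnth_nth 0). Qed.

(** Splitting [y] into idempotents adds a first variable, the degree of the coefficients. *)
Lemma act_cochain (H : finZmodType) m (co : H -> m.-tuple G) x (y : K) h :
  M y (cochain co x h) =
  \sum_(u : G * H) (eval_at y u.1 * eval_tuple h (co u.2)) *: coact pi x u.
Proof.
transitivity (\sum_g \sum_s (eval_at y g * eval_tuple h (co s)) *: coact pi x (g, s));
  last by rewrite pair_bigA; apply: eq_bigr => -[].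
rewrite act_idem; apply: eq_bigr => g _; rewrite (bil_sumr (act_bilinear M)) scaler_sumr.
apply: eq_bigr => s _; rewrite (bilZr (act_bilinear M)) scalerA.
by rewrite ffunE.
Qed.

Section Face1.
Variable x : gring A G.

Lemma face0_cochain1 : face M 0 (cochain co1 x) =1 cochain co2 (coact pi x).
Proof.
move=> h; rewrite [h]tuple2E face1_0 act_cochain; apply: eq_bigr => u _.
by rewrite eval_tuple1E eval_tuple2E.
Qed.

Lemma face1_cochain1 :
  face M 1 (cochain co1 x) =1 cochain co2 (gmap (pairf idfun idfun) x).
Proof.
move=> h; rewrite [h]tuple2E face1_1 cochain_gmap; apply: eq_bigr => s _.
by rewrite eval_tuple1E eval_tuple2E eval_atM.
Qed.

Lemma face2_cochain1 :
  face M 2 (cochain co1 x) =1 cochain co2 (gmap (pairf idfun \0) x).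
Proof.
move=> h; rewrite [h]tuple2E face1_2 cochain_gmap scaler_sumr.
by apply: eq_bigr => s _; rewrite eval_tuple1E eval_tuple2E scalerA mulrC.
Qed.
End Face1.

Section Face2.
Variable x : gring A (G * G)%type.

Lemma face0_cochain2 : face M 0 (cochain co2 x) =1 cochain co3 (coact pi x).
Proof.
move=> h; have [y [z [t ->]]] := tuple3P h; rewrite face2_0 act_cochain.
by apply: eq_bigr => u _; rewrite eval_tuple2E eval_tuple3E.
Qed.

Lemma face1_cochain2 :
  face M 1 (cochain co2 x) =1 cochain co3 (gmap (pairf fst idfun) x).
Proof.
move=> h; have [y [z [t ->]]] := tuple3P h; rewrite face2_1 cochain_gmap.
by apply: eq_bigr => u _; rewrite eval_tuple2E eval_tuple3E eval_atM mulrA.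
Qed.

Lemma face2_cochain2 :
  face M 2 (cochain co2 x) =1 cochain co3 (gmap (pairf fst (pairf snd snd)) x).
Proof.
move=> h; have [y [z [t ->]]] := tuple3P h; rewrite face2_2 cochain_gmap.
by apply: eq_bigr => u _; rewrite eval_tuple2E eval_tuple3E eval_atM.
Qed.

Lemma face3_cochain2 :
  face M 3 (cochain co2 x) =1 cochain co3 (gmap (pairf fst (pairf snd \0)) x).
Proof.
move=> h; have [y [z [t ->]]] := tuple3P h; rewrite face2_3 cochain_gmap scaler_sumr.
by apply: eq_bigr => u _; rewrite eval_tuple2E eval_tuple3E scalerA [counit t * _]mulrC -mulrA.
Qed.
End Face2.

Lemma eq_face m i (f g : m.-tuple K -> A) : f =1 g -> face M i f =1 face M i g.
Proof. by move=> fg h; rewrite /face; case: ifP; [|case: ifP]; rewrite fg. Qed.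

Lemma cochain1_multilinear (x : gring A G) : multilinear (cochain co1 x).
Proof.
move=> i h a y z.
have E v : [tuple if j == i then v else tnth h j | j < 1] = [tuple v].
  by rewrite [LHS]tuple1E tnth_mktuple [i]ord1.
rewrite !E scaler_sumr -big_split; apply: eq_bigr => s _ /=; rewrite !eval_tuple1E.
by rewrite (eval_linear s a y z) scalerDl scalerA.
Qed.

Lemma multilinear2_cochain (f : 2.-tuple K -> A) : multilinear f ->
  f =1 cochain co2 ([ffun u => f [tuple gidem k u.1; gidem k u.2]] : gring A (G * G)%type).
Proof.
move=> mf.
have bf : bilinear_for *:%R *:%R (fun x y => f [tuple x; y]).
  split=> [y | x] a u v.
    (* The entry of [[tuple y; y]] at the varying index is overwritten. *)
    have E v' : [tuple if j == 0 then v' else tnth [tuple y; y] j | j < 2] =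
      [tuple v'; y] by rewrite [LHS]tuple2E !tnth_mktuple.
    by have := mf 0 [tuple y; y] a u v; rewrite !E.
  have E v' : [tuple if j == 1 then v' else tnth [tuple x; x] j | j < 2] =
    [tuple x; v'] by rewrite [LHS]tuple2E !tnth_mktuple.
  by have := mf 1 [tuple x; x] a u v; rewrite !E.
move=> h; rewrite [h]tuple2E; move: (tnth h 0) (tnth h 1) => x y.
rewrite [in LHS](idem_basis x) [in LHS](idem_basis y) (bil_suml bf).
transitivity (\sum_a \sum_b (eval_at x a * eval_at y b) *: f [tuple gidem k a; gidem k b]);
  last by rewrite pair_bigA; apply: eq_bigr => -[a b] _; rewrite eval_tuple2E ffunE.
apply: eq_bigr => a _; rewrite (bil_sumr bf); apply: eq_bigr => b _.
by rewrite (bilZl bf) (bilZr bf) scalerA.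
Qed.
End LowDegree.

Lemma conv_cochain (k : fieldType) (p n : nat) (A : comFalgType k)
    (H : finZmodType) (m : nat) (co : H -> m.-tuple (cpow p n)) f g (x y : gring A H) :
    (forall s t i, tnth (co (s + t)) i = tnth (co s) i + tnth (co t) i) ->
    f =1 cochain co x -> g =1 cochain co y ->
  conv f g =1 cochain co (x * y).
Proof. by move=> coD fx gy h; rewrite (eq_conv fx gy) cochainM. Qed.

Section Differentials.
Variables (k : fieldType) (p n : nat) (A : comFalgType k).
Local Notation G := (cpow p n).
Local Notation K := (dual (group_algebra k (cyclic_power p n))).
Variable M : module_algebra K A.
Let pi := act_grading M.

Lemma differential_cochain1 (g : Reg K A 1) (x x' : gring A G) :
    g =1 cochain (@co1 p n) x -> reg_inv g =1 cochain (@co1 p n) x' ->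
  differential M g =1 cochain (@co2 p n) (coact pi x *
    (gmap (pairf idfun idfun) x' * (gmap (pairf idfun \0) x * 1))).
Proof.
move=> gx gx' h; rewrite differential1E; move: h.
apply: conv_cochain; first exact: co2D.
  by move=> h; rewrite (eq_face M 0 gx) face0_cochain1.
apply: conv_cochain; first exact: co2D.
  by move=> h; rewrite (eq_face M 1 gx') face1_cochain1.
apply: conv_cochain; first exact: co2D.
  by move=> h; rewrite (eq_face M 2 gx) face2_cochain1.
exact/cochain1/co2D.
Qed.

Lemma differential_cochain2 (f : Reg K A 2) (x x' : gring A (G * G)%type) :
    f =1 cochain (@co2 p n) x -> reg_inv f =1 cochain (@co2 p n) x' ->
  differential M f =1 cochain (@co3 p n) (coact pi x *
    (gmap (pairf fst idfun) x' * (gmap (pairf fst (pairf snd snd)) x *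
      (gmap (pairf fst (pairf snd \0)) x' * 1)))).
Proof.
move=> fx fx' h; rewrite differential2E; move: h.
apply: conv_cochain; first exact: co3D.
  by move=> h; rewrite (eq_face M 0 fx) face0_cochain2.
apply: conv_cochain; first exact: co3D.
  by move=> h; rewrite (eq_face M 1 fx') face1_cochain2.
apply: conv_cochain; first exact: co3D.
  by move=> h; rewrite (eq_face M 2 fx) face2_cochain2.
apply: conv_cochain; first exact: co3D.
  by move=> h; rewrite (eq_face M 3 fx') face3_cochain2.
exact/cochain1/co3D.
Qed.

Lemma conv_cochain1_inv (x x' : gring A G) : x * x' = 1 ->
  conv (cochain (@co1 p n) x) (cochain (@co1 p n) x') =1 @conv1 k K A 1.
Proof.
move=> xx' h; rewrite cochainM; last exact: co1D.
by rewrite xx' -cochain1 //; apply: co1D.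
Qed.

Definition reg_cochain1 (x x' : gring A G) (xx' : x * x' = 1) : Reg K A 1 :=
  Build_Reg (cochain1_multilinear x) (cochain1_multilinear x')
    (conv_cochain1_inv xx') (conv_cochain1_inv (etrans (mulrC x' x) xx')).
End Differentials.

Theorem theorem6p4 (k : closedFieldType) (p : nat) (charp : p \in [pchar k])
    (n : nat) (n_gt0 : (0 < n)%N) (A : comFalgType k)
    (M : module_algebra (dual (group_algebra k (cyclic_power p n))) A) :
  sweedler_trivial M 2.
Proof.
move=> f cf.
have p_gt1 := prime_gt1 (pcharf_prime charp).
have [x fx] : exists x, f =1 cochain (@co2 p n) x.
  by eexists; apply: multilinear2_cochain; apply: reg_fun_multilinear.
have [x' fx'] : exists x, reg_inv f =1 cochain (@co2 p n) x.
  by eexists; apply: multilinear2_cochain; apply: reg_inv_multilinear.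
have xx' : x * x' = 1.
  apply: (cochain_inj (@co2_inj p n)) => h.
  by rewrite -(conv_cochain (@co2D p n) fx fx') reg_funV -cochain1 //; apply: co2D.
have cx : cocycle2 (act_grading M) x.
  have := differential_cochain2 M fx fx' => dx.
  have := cochain_inj (@co3_inj p n) (fun h =>
    etrans (esym (dx h)) (etrans (cf h) (cochain1 A (@co3D p n) h))).
  rewrite mulr1 /cocycle2 {dx}.
  set y0 := coact _ _; set y1' := gmap _ x'; set y2 := gmap _ x.
  set y3' := gmap _ x' => e.
  set y1 := gmap _ x; set y3 := gmap _ x.
  have y1y1' : y1 * y1' = 1 by rewrite -rmorphM xx' rmorph1.
  have y3y3' : y3 * y3' = 1 by rewrite -rmorphM xx' rmorph1.
  (* Multiplying [e] by [y1 * y3] moves the inverse faces to the other side. *)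
  transitivity (y0 * (y1' * (y2 * y3')) * (y1 * y3)); last by rewrite e mul1r.
  transitivity (y0 * y2 * (y1 * y1') * (y3 * y3')); last by ring.
  by rewrite y1y1' y3y3' !mulr1.
pose chi i : {additive cpow p n -> k} := HB.pack (@cpow_char p n k i)
  (GRing.isZmodMorphism.Build _ _ _ (cpow_char_is_additive charp p_gt1 i)).
have [] := @gring_H2_trivial k p charp A _ (act_grading M) n chi (@cpow_gen p n)
  (fun i s => cpow_charX charp i s) (fun i j => cpow_char_gen charp p_gt1 i j)
  (fun s => @cpow_char_sep p n k charp p_gt1 s) (cpowMn charp p_gt1) x x' xx' cx.
move=> u [u' [uu' xu]]; exists (reg_cochain1 uu') => h.
apply: etrans (esym (fx h)); rewrite xu.
rewrite (@differential_cochain1 k p n A M (reg_cochain1 uu') u u'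
  (fun=> erefl) (fun=> erefl)).
by rewrite mulr1 mulrA.
Qed.
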